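(* The fundamental group $\pi_1(A_4,\ast)$ of the space $A_4$ of oriented affine configurations of four distinct ordered points in the real plane is isomorphic to the free group on eleven generators.
   Context: Let $E_4=\{(p_1,p_2,p_3,p_4) : p_i\in\mathbb{R}^2,\ p_i\neq p_j \text{ for } i\neq j,\ \langle p_1,p_2,p_3,p_4\rangle=\mathbb{R}^2\}\subset(\mathbb{R}^2)^4=\mathbb{R}^{8}$ with the subspace topology, where $\langle p_1,\dots,p_4\rangle$ denotes the affine span; that is, $E_4$ is the space of ordered $4$-tuples of distinct points of the plane that are not all collinear. The group $\mathrm{Aff}_+(\mathbb{R}^2)$ of orientation-preserving affine transformations of $\mathbb{R}^2$ acts (freely) on $E_4$ diagonally, $f\cdot(p_1,\dots,p_4)=(f(p_1),\dots,f(p_4))$, and $A_4:=E_4/\mathrm{Aff}_+(\mathbb{R}^2)$ with the quotient topology. The symbol $\ast$ denotes a base point in $A_4$. *)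

(* Defs.v *)
From HB Require Import structures.
From mathcomp Require Import all_boot all_order all_algebra.
From mathcomp Require Import generic_quotient.
From mathcomp Require Import all_classical all_reals all_analysis.
From mathcomp Require Import lra.
From mathcomp Require Import homotopy.

Set Implicit Arguments.
Unset Strict Implicit.
Unset Printing Implicit Defensive.

Import Order.TTheory GRing.Theory Num.Theory.
Import numFieldNormedType.Exports.

Local Open Scope classical_set_scope.
Local Open Scope ring_scope.
Local Open Scope quotient_scope.

Section unit_interval.
Context {R : realType}.

(* A bipointed copy of [0, 1], so that it can serve as the domain of paths. *)
Definition unit_itv : Type := set_type (`[0, 1]%classic : set R).

HB.instance Definition _ :=
  Topological.copy unit_itv (set_type (`[0, 1]%classic : set R)).

Lemma unit_itv_ge0 (t : unit_itv) : 0 <= \val t.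
Proof. by have /set_mem := valP t; rewrite /= in_itv /= => /andP[]. Qed.

Lemma unit_itv_le1 (t : unit_itv) : \val t <= 1.
Proof. by have /set_mem := valP t; rewrite /= in_itv /= => /andP[]. Qed.

Lemma clamp_subproof (r : R) :
  Num.max 0 (Num.min 1 r) \in (`[0, 1]%classic : set R).
Proof. by rewrite inE /= in_itv /= le_max lexx ge_max ler01 ge_min lexx. Qed.

Definition clamp (r : R) : unit_itv := 
  exist (fun x => x \in (`[0, 1]%classic : set R)) _ (clamp_subproof r).

Lemma clampE (r : R) : 0 <= r <= 1 -> \val (clamp r) = r.
Proof. by move=> /andP[r0 r1] /=; rewrite (min_r r1) (max_r r0). Qed.

Lemma unit_itv_inj (s t : unit_itv) : \val s = \val t -> s = t.
Proof. exact: val_inj. Qed.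

Lemma clampK (t : unit_itv) : clamp (\val t) = t.
Proof. by apply: unit_itv_inj; rewrite clampE // unit_itv_ge0 unit_itv_le1. Qed.

Lemma clamp_le0 (r : R) : r <= 0 -> clamp r = clamp 0.
Proof.
move=> r0; apply: unit_itv_inj; rewrite /= (min_r (le_trans r0 ler01)).
by rewrite (max_l r0) min_r ?ler01 // maxxx.
Qed.

Lemma clamp_ge1 (r : R) : 1 <= r -> clamp r = clamp 1.
Proof. by move=> r1; apply: unit_itv_inj; rewrite /= (min_l r1) minxx. Qed.

Lemma clamp_neq01 : clamp 0 != clamp 1.
Proof.
apply/eqP => /(congr1 val); rewrite !clampE ?lexx ?ler01 // => /eqP.
by rewrite eq_sym oner_eq0.
Qed.

HB.instance Definition _ :=
  isBiPointed.Build unit_itv clamp_neq01.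

End unit_interval.
Arguments unit_itv R : clear implicits.

Section unit_interval_topology.
Context {R : realType}.
Local Notation I := (unit_itv R).

Lemma zeroE : zero = clamp 0 :> I. Proof. by []. Qed.

Lemma oneE : one = clamp 1 :> I. Proof. by []. Qed.

Lemma val_zero : \val (zero : I) = 0.
Proof. by rewrite zeroE clampE // lexx ler01. Qed.

Lemma val_one : \val (one : I) = 1.
Proof. by rewrite oneE clampE // lexx ler01. Qed.

Lemma val_continuous : continuous (fun t : I => \val t : R).
Proof. exact: (@initial_continuous I R (fun t : I => \val t)). Qed.

Lemma clamp_continuous : continuous (@clamp R : R -> I).
Proof.
apply/continuousP => _ [B oB <-].
have /continuousP : continuous (fun r : R => Num.max 0 (Num.min 1 r)).
  move=> r; apply: (@continuous_max R R (fun=> 0) (fun r => Num.min 1 r) r).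
    exact: cvg_cst.
  apply: (@continuous_min R R (fun=> 1) id r); first exact: cvg_cst.
  exact: cvg_id.
by move=> /(_ _ oB).
Qed.

Lemma clamp_comp_continuous (X : topologicalType) (u : X -> R) :
  continuous u -> continuous (fun x => clamp (u x)).
Proof.
by move=> cu x; apply: continuous_comp; [exact: cu|exact: clamp_continuous].
Qed.

Lemma val_comp_continuous (X : topologicalType) (u : X -> I) :
  continuous u -> continuous (fun x => \val (u x) : R).
Proof.
by move=> cu x; apply: continuous_comp; [exact: cu|exact: val_continuous].
Qed.

Lemma pasting (X Y : topologicalType) (u : X -> R) (c : R) (f g : X -> Y) :
    continuous u -> continuous f -> continuous g ->
    (forall x, u x = c -> f x = g x) ->
  continuous (fun x => if u x <= c then f x else g x).
Proof.
move=> cu cf cg fg; apply/continuous_subspace_setT.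
rewrite (_ : setT = [set x | u x <= c] `|` [set x | c <= u x]); last first.
  apply/seteqP; split => // x _ /=.
  by have /orP := le_total (u x) c.
apply: withinU_continuous.
- by apply: (@closed_comp _ _ u [set r | r <= c]) => //; exact: closed_le.
- by apply: (@closed_comp _ _ u [set r | c <= r]) => //; exact: closed_ge.
- apply: (@subspace_eq_continuous _ _ _ f); last exact: continuous_subspaceT.
  by move=> x /set_mem /= xc; rewrite /from_subspace xc.
- apply: (@subspace_eq_continuous _ _ _ g); last exact: continuous_subspaceT.
  move=> x /set_mem /= cx; rewrite /from_subspace; case: ifPn => // xc.
  by apply/esym/fg/le_anti; rewrite xc cx.
Qed.

End unit_interval_topology.

Section path_operations.
Context {R : realType} {T : topologicalType}.
Local Notation I := (unit_itv R).

(* In each branch the argument of [clamp] already lies in the unit interval. *)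
Definition concat_fun (p q : I -> T) (t : I) : T :=
  if \val t <= 2^-1 then p (clamp (2 * \val t)) else q (clamp (2 * \val t - 1)).

Lemma pasting_concat (X : topologicalType) (u : X -> R) (f g : X * I -> T) :
    continuous u -> continuous f -> continuous g ->
    (forall x, f (x, one) = g (x, zero)) ->
  continuous (fun x => if u x <= 2^-1 then f (x, clamp (2 * u x))
                       else g (x, clamp (2 * u x - 1))).
Proof.
have c2 (v : X -> R) : continuous v -> continuous (fun x => 2 * v x).
  by move=> cv x; apply: cvgM; [exact: cvg_cst|exact: cv].
have cpair (h : X * I -> T) (v : X -> R) : continuous h -> continuous v ->
    continuous (fun x => h (x, clamp (v x))).
  move=> ch cv x.
  apply: (@continuous_comp _ _ _ (fun x => (x, clamp (v x))) h); last exact: ch.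
  apply: (@cvg_pair X X I (nbhs x) (nbhs x) (nbhs (clamp (v x)))).
    exact: cvg_id.
  exact: clamp_comp_continuous.
move=> cu cf cg fg; apply: pasting => //.
- by apply: cpair => //; exact: c2.
- apply: cpair => // x; apply: cvgB; [exact: c2|exact: cvg_cst].
- by move=> x ->; rewrite mulfV ?pnatr_eq0 // subrr; exact: fg.
Qed.

Section concat.
Context {x y z : T} (p : {path I from x to y}) (q : {path I from y to z}).

Let concat_continuous : continuous (concat_fun p q).
Proof.
apply: (@pasting_concat I (fun t => \val t) (p \o snd) (q \o snd)).
- exact: val_continuous.
- by move=> t; apply: continuous_comp; [exact: cvg_snd|exact: cts_fun].
- by move=> t; apply: continuous_comp; [exact: cvg_snd|exact: cts_fun].
- by move=> t /=; rewrite path_one path_zero.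
Qed.

Let concat_zero : concat_fun p q zero = x.
Proof.
by rewrite /concat_fun val_zero invr_ge0 ler0n mulr0 -zeroE path_zero.
Qed.

Let concat_one : concat_fun p q one = z.
Proof.
rewrite /concat_fun val_one ifF; last by apply/negbTE; rewrite -ltNge; lra.
by rewrite (_ : 2 * 1 - 1 = 1); [rewrite -oneE path_one|lra].
Qed.

Definition path_concat : {path I from x to z} :=
  mk_path concat_continuous concat_zero concat_one.

End concat.

Section reverse.
Context {x y : T} (p : {path I from x to y}).

Let reverse_continuous : continuous (fun t : I => p (clamp (1 - \val t))).
Proof.
move=> t; apply: (@continuous_comp _ _ _ (fun t : I => clamp (1 - \val t)) p).
  apply: clamp_comp_continuous => {}t.
  apply: (@continuousB R R I (fun=> 1) (fun t : I => \val t : R)).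
    exact: cst_continuous.
  exact: val_continuous.
exact: cts_fun.
Qed.

Let reverse_zero : p (clamp (1 - \val (zero : I))) = y.
Proof. by rewrite val_zero subr0 -oneE path_one. Qed.

Let reverse_one : p (clamp (1 - \val (one : I))) = x.
Proof. by rewrite val_one subrr -zeroE path_zero. Qed.

Definition path_reverse : {path I from y to x} :=
  mk_path reverse_continuous reverse_zero reverse_one.

End reverse.

Definition path_const (x : T) : {path I from x to x} := cst x.

Definition path_homotopic {x y : T} (p q : {path I from x to y}) : bool :=
  `[< exists H : I * I -> T,
      [/\ continuous H,
          forall t, H (t, zero) = p t, forall t, H (t, one) = q t,
          forall s, H (zero, s) = x & forall s, H (one, s) = y] >].

End path_operations.

Section path_homotopy_theory.
Context {R : realType} {T : topologicalType}.
Local Notation I := (unit_itv R).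
Implicit Types x y z w : T.

Lemma reparam_homotopic x y (f : I -> T) (phi psi : I -> I)
    (p q : {path I from x to y}) :
    continuous f -> continuous phi -> continuous psi ->
    phi zero = psi zero -> phi one = psi one ->
    p =1 f \o phi -> q =1 f \o psi ->
  path_homotopic p q.
Proof.
move=> cf cphi cpsi e0 e1 pE qE; apply/asboolP.
exists (fun ts => f (clamp ((1 - \val ts.2) * \val (phi ts.1)
                            + \val ts.2 * \val (psi ts.1)))).
split => [|t|t|s|s].
- have cphi1 : continuous (fun ts : I * I => \val (phi ts.1) : R).
    apply: val_comp_continuous => ts.
    by apply: continuous_comp; [exact: cvg_fst|exact: cphi].
  have cpsi1 : continuous (fun ts : I * I => \val (psi ts.1) : R).
    apply: val_comp_continuous => ts.
    by apply: continuous_comp; [exact: cvg_fst|exact: cpsi].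
  have cs : continuous (fun ts : I * I => \val ts.2 : R).
    by apply: val_comp_continuous => ts; exact: cvg_snd.
  move=> ts; apply: (@continuous_comp _ _ _ (fun ts : I * I =>
    clamp ((1 - \val ts.2) * \val (phi ts.1) + \val ts.2 * \val (psi ts.1))) f).
    apply: clamp_comp_continuous => {}ts.
    apply: (@continuousD R R _
      (fun ts : I * I => (1 - \val ts.2) * \val (phi ts.1) : R)
      (fun ts : I * I => \val ts.2 * \val (psi ts.1) : R)); last first.
      by apply: (@continuousM R _ (fun ts : I * I => \val ts.2 : R)
        (fun ts : I * I => \val (psi ts.1) : R)); [exact: cs|exact: cpsi1].
    apply: (@continuousM R _ (fun ts : I * I => 1 - \val ts.2 : R)
      (fun ts : I * I => \val (phi ts.1) : R)); last exact: cphi1.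
    apply: (@continuousB R R _ (fun=> 1) (fun ts : I * I => \val ts.2 : R)).
      exact: cst_continuous.
    exact: cs.
  exact: cf.
- by rewrite val_zero subr0 mul1r mul0r addr0 clampK pE.
- by rewrite val_one subrr mul1r mul0r add0r clampK qE.
- rewrite /= -e0 -mulrDl subrK mul1r clampK.
  by rewrite -[f _]/((f \o phi) zero) -pE path_zero.
- rewrite /= -e1 -mulrDl subrK mul1r clampK.
  by rewrite -[f _]/((f \o phi) one) -pE path_one.
Qed.

Lemma path_homotopic_refl x y : reflexive (@path_homotopic R T x y).
Proof.
move=> p; apply: (@reparam_homotopic _ _ p id id) => //; first exact: cts_fun.
  by move=> t; exact: cvg_id.
by move=> t; exact: cvg_id.
Qed.

Lemma path_homotopic_trans x y : transitive (@path_homotopic R T x y).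
Proof.
move=> q p r /asboolP[H [cH H0 H1 Hx Hy]] /asboolP[K [cK K0 K1 Kx Ky]].
apply/asboolP; exists (fun ts : I * I => if \val ts.2 <= 2^-1 :> R
   then H (ts.1, clamp (2 * \val ts.2))
   else K (ts.1, clamp (2 * \val ts.2 - 1))).
split => [|t|t|s|s].
- apply: (@pasting_concat R T (I * I)%type (fun ts => \val ts.2)
    (fun u => H (u.1.1, u.2)) (fun u => K (u.1.1, u.2)))
    => [|[[t s] v]|[[t s] v]|[t s] /=].
  + by apply: val_comp_continuous => ts; exact: cvg_snd.
  + apply: (@continuous_comp _ _ _ (fun u : (I * I) * I => (u.1.1, u.2)) H);
      last exact: cH.
    apply: (@cvg_pair _ I I _ (nbhs t) (nbhs v)); last exact: cvg_snd.
    by apply: cvg_comp; exact: cvg_fst.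
  + apply: (@continuous_comp _ _ _ (fun u : (I * I) * I => (u.1.1, u.2)) K);
      last exact: cK.
    apply: (@cvg_pair _ I I _ (nbhs t) (nbhs v)); last exact: cvg_snd.
    by apply: cvg_comp; exact: cvg_fst.
  + by rewrite H1 K0.
- by rewrite val_zero invr_ge0 ler0n mulr0 -zeroE H0.
- rewrite val_one ifF; last by apply/negbTE; rewrite -ltNge; lra.
  by rewrite (_ : 2 * 1 - 1 = 1) ?K1 //; lra.
- by rewrite /= Hx Kx if_same.
- by rewrite /= Hy Ky if_same.
Qed.

Lemma pair_map_continuous (X Y Z W : topologicalType)
    (f : X -> Z) (g : Y -> W) :
  continuous f -> continuous g -> continuous (fun xy => (f xy.1, g xy.2)).
Proof.
move=> cf cg [a b].
apply: (@cvg_pair _ Z W _ (nbhs (f a)) (nbhs (g b))).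
  by apply: cvg_comp; [exact: cvg_fst|exact: cf].
by apply: cvg_comp; [exact: cvg_snd|exact: cg].
Qed.

Lemma flip_continuous : continuous (fun t : I => clamp (1 - \val t) : I).
Proof.
apply: clamp_comp_continuous => t.
apply: (@continuousB R R I (fun=> 1) (fun t : I => \val t : R)).
  exact: cst_continuous.
exact: val_continuous.
Qed.

Lemma path_homotopic_sym x y : symmetric (@path_homotopic R T x y).
Proof.
suff S p q : @path_homotopic R T x y p q -> path_homotopic q p.
  by move=> p q; apply/idP/idP; exact: S.
move=> /asboolP[H [cH H0 H1 Hx Hy]].
apply/asboolP; exists (fun ts : I * I => H (ts.1, clamp (1 - \val ts.2))).
split => [|t|t|s|s].
- move=> ts; apply: (@continuous_comp _ _ _
    (fun ts : I * I => (ts.1, clamp (1 - \val ts.2))) H); last exact: cH.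
  apply: (@pair_map_continuous I I I I id (fun t => clamp (1 - \val t))).
    by move=> ?; exact: cvg_id.
  exact: flip_continuous.
- by rewrite val_zero subr0 -oneE H1.
- by rewrite val_one subrr -zeroE H0.
- exact: Hx.
- exact: Hy.
Qed.

Lemma concat_homotopic x y z (p p' : {path I from x to y})
    (q q' : {path I from y to z}) :
  path_homotopic p p' -> path_homotopic q q' ->
  path_homotopic (path_concat p q) (path_concat p' q').
Proof.
move=> /asboolP[H [cH H0 H1 Hx Hy]] /asboolP[K [cK K0 K1 Kx Ky]].
apply/asboolP; exists (fun ts : I * I => if \val ts.1 <= 2^-1 :> R
   then H (clamp (2 * \val ts.1), ts.2)
   else K (clamp (2 * \val ts.1 - 1), ts.2)).
split => [|t|t|s|s].
- apply: (@pasting_concat R T (I * I)%type (fun ts => \val ts.1)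
    (fun u => H (u.2, u.1.2)) (fun u => K (u.2, u.1.2)))
    => [|[[t s] v]|[[t s] v]|[t s] /=].
  + by apply: val_comp_continuous => ts; exact: cvg_fst.
  + apply: (@continuous_comp _ _ _ (fun u : (I * I) * I => (u.2, u.1.2)) H);
      last exact: cH.
    apply: (@cvg_pair _ I I _ (nbhs v) (nbhs s)); first exact: cvg_snd.
    by apply: cvg_comp; [exact: cvg_fst|exact: cvg_snd].
  + apply: (@continuous_comp _ _ _ (fun u : (I * I) * I => (u.2, u.1.2)) K);
      last exact: cK.
    apply: (@cvg_pair _ I I _ (nbhs v) (nbhs s)); first exact: cvg_snd.
    by apply: cvg_comp; [exact: cvg_fst|exact: cvg_snd].
  + by rewrite Hy Kx.
- by rewrite /= H0 K0.
- by rewrite /= H1 K1.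
- by rewrite val_zero invr_ge0 ler0n mulr0 -zeroE Hx.
- rewrite val_one ifF; last by apply/negbTE; rewrite -ltNge; lra.
  by rewrite (_ : 2 * 1 - 1 = 1) ?Ky //; lra.
Qed.

Lemma reverse_homotopic x y (p q : {path I from x to y}) :
  path_homotopic p q -> path_homotopic (path_reverse p) (path_reverse q).
Proof.
move=> /asboolP[H [cH H0 H1 Hx Hy]].
apply/asboolP; exists (fun ts : I * I => H (clamp (1 - \val ts.1), ts.2)).
split => [|t|t|s|s].
- move=> ts; apply: (@continuous_comp _ _ _
    (fun ts : I * I => (clamp (1 - \val ts.1), ts.2)) H); last exact: cH.
  apply: (@pair_map_continuous I I I I (fun t => clamp (1 - \val t)) id).
    exact: flip_continuous.
  by move=> ?; exact: cvg_id.
- by rewrite H0.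
- by rewrite H1.
- by rewrite val_zero subr0 -oneE Hy.
- by rewrite val_one subrr -zeroE Hx.
Qed.

Lemma affine_continuous (a b : R) :
  continuous (fun t : I => a * \val t + b : R).
Proof.
move=> t.
apply: (@continuousD R R I (fun t => a * \val t) (fun=> b)); last first.
  exact: cst_continuous.
apply: (@continuousM R I (fun=> a) (fun t => \val t : R)).
  exact: cst_continuous.
exact: val_continuous.
Qed.

Lemma min_continuous (X : topologicalType) (f g : X -> R) :
  continuous f -> continuous g -> continuous (fun t => Num.min (f t) (g t)).
Proof.
by move=> cf cg t; exact: (@continuous_min R X f g t (cf t) (cg t)).
Qed.

Lemma min_affine_continuous (a b c d : R) :
  continuous (fun t : I =>
    clamp (Num.min (a * \val t + b) (c * \val t + d)) : I).
Proof.
by apply/clamp_comp_continuous/min_continuous; exact: affine_continuous.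
Qed.

Lemma path_concatE x y z (p : {path I from x to y}) (q : {path I from y to z})
    (t : I) :
  path_concat p q t = if \val t <= 2^-1 :> R then p (clamp (2 * \val t))
                      else q (clamp (2 * \val t - 1)).
Proof. by []. Qed.

Lemma path_reverseE x y (p : {path I from x to y}) (t : I) :
  path_reverse p t = p (clamp (1 - \val t)).
Proof. by []. Qed.

Lemma path_concat1 x y (p : {path I from x to y}) :
  path_homotopic (path_concat p (path_const y)) p.
Proof.
apply: (@reparam_homotopic _ _ p
  (fun t => clamp (Num.min (2 * \val t + 0) (2 * \val t + 0))) id).
- exact: cts_fun.
- exact: min_affine_continuous.
- by move=> t; exact: cvg_id.
- by rewrite minxx val_zero mulr0 addr0.
- by rewrite minxx val_one; apply: clamp_ge1; lra.
- move=> t; rewrite path_concatE /comp minxx addr0.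
  case: leP => // t2.
  have -> : clamp (2 * \val t) = one by apply: clamp_ge1; lra.
  by rewrite path_one.
- by [].
Qed.

Lemma path_1concat x y (p : {path I from x to y}) :
  path_homotopic (path_concat (path_const x) p) p.
Proof.
apply: (@reparam_homotopic _ _ p
  (fun t => clamp (Num.min (2 * \val t + (-1)) (2 * \val t + (-1)))) id).
- exact: cts_fun.
- exact: min_affine_continuous.
- by move=> t; exact: cvg_id.
- by rewrite minxx val_zero; apply: clamp_le0; lra.
- by rewrite minxx val_one oneE; congr clamp; lra.
- move=> t; rewrite path_concatE /comp minxx.
  case: leP => // t2.
  have -> : clamp (2 * \val t + -1) = zero by apply: clamp_le0; lra.
  by rewrite path_zero.
- by [].
Qed.

Lemma path_concatV x y (p : {path I from x to y}) :
  path_homotopic (path_concat p (path_reverse p)) (path_const x).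
Proof.
apply: (@reparam_homotopic _ _ p
  (fun t => clamp (Num.min (2 * \val t + 0) (- 2 * \val t + 2))) (fun=> zero)).
- exact: cts_fun.
- exact: min_affine_continuous.
- exact: cst_continuous.
- by rewrite val_zero min_l ?mulr0 ?addr0 //; lra.
- by rewrite val_one min_r; [apply: clamp_le0|]; lra.
- move=> t; have t0 := unit_itv_ge0 t; have t1 := unit_itv_le1 t.
  rewrite path_concatE /comp; case: leP => t2.
    by rewrite min_l ?addr0 //; lra.
  rewrite min_r; last by lra.
  by rewrite path_reverseE clampE; [congr (p (clamp _))|]; lra.
- by move=> t; rewrite /= path_zero.
Qed.

Lemma path_concatA x y z w (p : {path I from x to y}) (q : {path I from y to z})
    (r : {path I from z to w}) :
  path_homotopic (path_concat p (path_concat q r))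
                 (path_concat (path_concat p q) r).
Proof.
pose phi (t : I) : I := clamp (Num.min (2 * \val t + 0)
  (Num.min (1 * \val t + 4^-1) (2^-1 * \val t + 2^-1))).
rewrite path_homotopic_sym.
apply: (@reparam_homotopic _ _ (path_concat p (path_concat q r)) phi id).
- exact: cts_fun.
- apply/clamp_comp_continuous/min_continuous; first exact: affine_continuous.
  by apply: min_continuous; exact: affine_continuous.
- by move=> t; exact: cvg_id.
- by rewrite /phi val_zero min_l ?mulr0 ?addr0 // le_min; lra.
- rewrite /phi val_one min_r ?ge_min; last by lra.
  by rewrite min_r ?oneE; [congr clamp|]; lra.
- move=> t; have t0 := unit_itv_ge0 t; have t1 := unit_itv_le1 t.
  rewrite !path_concatE /comp path_concatE /phi.
  have [t2|t2] := leP (\val t) 2^-1.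
    rewrite ?path_concatE clampE; last by lra.
    have [t4|t4] := leP (2 * \val t) 2^-1.
      rewrite min_l ?le_min; last by lra.
      by rewrite addr0 clampE ?t4 //; lra.
    rewrite min_r ?ge_min; last by lra.
    rewrite min_l; last by lra.
    rewrite (@clampE _ (1 * _ + _)); last by lra.
    case: leP => t5; first by exfalso; lra.
    rewrite ?path_concatE clampE; last by lra.
    rewrite ifT; last by lra.
    by congr (q (clamp _)); lra.
  rewrite min_r ?ge_min; last by lra.
  rewrite min_r; last by lra.
  rewrite (@clampE _ (_ * _ + _)); last by lra.
  case: leP => t5; first by exfalso; lra.
  rewrite ?path_concatE clampE; last by lra.
  case: leP => t6; first by exfalso; lra.
  by congr (r (clamp _)); lra.
- by [].
Qed.

Lemma path_reverseK x y (p : {path I from x to y}) :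
  path_reverse (path_reverse p) = p.
Proof.
apply/path_eqP => t; rewrite !path_reverseE.
have t0 := unit_itv_ge0 t; have t1 := unit_itv_le1 t.
by rewrite clampE ?subKr ?clampK //; lra.
Qed.

Lemma path_Vconcat x y (p : {path I from x to y}) :
  path_homotopic (path_concat (path_reverse p) p) (path_const y).
Proof.
by rewrite -{2}(path_reverseK p); exact: path_concatV.
Qed.

End path_homotopy_theory.

Section fundamental_group.
Context (R : realType) (T : topologicalType) (x : T).
Local Notation I := (unit_itv R).
Local Notation loop := {path I from x to x}.

Canonical path_homotopic_equiv :=
  EquivRel (@path_homotopic R T x x) (@path_homotopic_refl R T x x)
    (@path_homotopic_sym R T x x) (@path_homotopic_trans R T x x).

Definition fundamental_group : Type := {eq_quot (@path_homotopic R T x x)}.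

HB.instance Definition _ := Choice.on fundamental_group.
HB.instance Definition _ := EqQuotient.on fundamental_group.

Local Notation class := \pi_fundamental_group.

Definition pi1_one : fundamental_group := class (path_const x : loop).

Definition pi1_inv (a : fundamental_group) : fundamental_group :=
  class (path_reverse (repr a)).

Definition pi1_mul (a b : fundamental_group) : fundamental_group :=
  class (path_concat (repr a) (repr b)).

Lemma pi1_eqP (p q : loop) :
  reflect (class p = class q) (path_homotopic p q).
Proof. exact: eqmodP. Qed.

Lemma repr_pi1 (p : loop) : path_homotopic (repr (class p)) p.
Proof. by apply/pi1_eqP; rewrite reprK. Qed.

Lemma pi1_mulE (p q : loop) :
  pi1_mul (class p) (class q) = class (path_concat p q).
Proof. by apply/pi1_eqP/concat_homotopic; exact: repr_pi1. Qed.

Lemma pi1_invE (p : loop) : pi1_inv (class p) = class (path_reverse p).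
Proof. by apply/pi1_eqP/reverse_homotopic; exact: repr_pi1. Qed.

Let pi1_mulA : associative pi1_mul.
Proof.
elim/quotW=> p; elim/quotW=> q; elim/quotW=> r.
rewrite (pi1_mulE q r) (pi1_mulE p (path_concat q r)).
rewrite (pi1_mulE p q) (pi1_mulE (path_concat p q) r).
by apply/pi1_eqP; exact: path_concatA.
Qed.

Let pi1_1mul : left_id pi1_one pi1_mul.
Proof.
by elim/quotW=> p; rewrite pi1_mulE; apply/pi1_eqP; exact: path_1concat.
Qed.

Let pi1_mul1 : right_id pi1_one pi1_mul.
Proof.
by elim/quotW=> p; rewrite pi1_mulE; apply/pi1_eqP; exact: path_concat1.
Qed.

Let pi1_Vmul : left_inverse pi1_one pi1_inv pi1_mul.
Proof.
elim/quotW=> p; rewrite pi1_invE pi1_mulE.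
by apply/pi1_eqP; exact: path_Vconcat.
Qed.

Let pi1_mulV : right_inverse pi1_one pi1_inv pi1_mul.
Proof.
elim/quotW=> p; rewrite pi1_invE pi1_mulE.
by apply/pi1_eqP; exact: path_concatV.
Qed.

HB.instance Definition _ :=
  isGroup.Build fundamental_group pi1_mulA pi1_1mul pi1_mul1 pi1_Vmul pi1_mulV.

End fundamental_group.

Section free_group.
Context (X : choiceType).

(* The letters (x, true) and (x, false) stand for x and its inverse. *)
Definition word : Type := seq (X * bool).

HB.instance Definition _ := Choice.on word.

Inductive elementary_reduction : word -> word -> Prop :=
| Cancel (u v : word) (x : X) (b : bool) :
    elementary_reduction (u ++ (x, b) :: (x, ~~ b) :: v) (u ++ v).

Inductive word_equivalent : word -> word -> Prop :=
| word_equivalent_step u v : elementary_reduction u v -> word_equivalent u v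
| word_equivalent_refl u : word_equivalent u u
| word_equivalent_sym u v : word_equivalent u v -> word_equivalent v u
| word_equivalent_trans u v w :
    word_equivalent u v -> word_equivalent v w -> word_equivalent u w.

Definition word_equiv (u v : word) : bool := `[< word_equivalent u v >].

Lemma word_equiv_refl : reflexive word_equiv.
Proof. by move=> u; apply/asboolP; exact: word_equivalent_refl. Qed.

Lemma word_equiv_sym : symmetric word_equiv.
Proof. by move=> u v; apply/asboolP/asboolP; exact: word_equivalent_sym. Qed.

Lemma word_equiv_trans : transitive word_equiv.
Proof.
move=> v u w /asboolP uv /asboolP vw.
by apply/asboolP; exact: word_equivalent_trans uv vw.
Qed.

Canonical word_equiv_equiv :=
  EquivRel word_equiv word_equiv_refl word_equiv_sym word_equiv_trans.

Definition free_group : Type := {eq_quot word_equiv}.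

HB.instance Definition _ := Choice.on free_group.
HB.instance Definition _ := EqQuotient.on free_group.

Definition word_inv (u : word) : word := rev [seq (a.1, ~~ a.2) | a <- u].

Definition free_group_one : free_group := \pi_free_group ([::] : word).

Definition free_group_inv (a : free_group) : free_group :=
  \pi_free_group (word_inv (repr a)).

Definition free_group_mul (a b : free_group) : free_group :=
  \pi_free_group (repr a ++ repr b : word).

Lemma free_group_eqP (u v : word) :
  reflect (\pi_free_group u = \pi_free_group v) (word_equiv u v).
Proof. exact: eqmodP. Qed.

Lemma repr_free_group (u : word) : word_equiv (repr (\pi_free_group u)) u.
Proof. by apply/free_group_eqP; rewrite reprK. Qed.

Lemma word_equiv_catl (w u v : word) :
  word_equiv u v -> word_equiv (w ++ u) (w ++ v).
Proof.
move=> /asboolP uv; apply/asboolP; elim: uv => {u v}.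
- move=> _ _ [u v x b]; rewrite !catA.
  exact/word_equivalent_step/Cancel.
- move=> u; exact: word_equivalent_refl.
- move=> u v _; exact: word_equivalent_sym.
- move=> u v t _ uv _; exact: word_equivalent_trans.
Qed.

Lemma word_equiv_catr (w u v : word) :
  word_equiv u v -> word_equiv (u ++ w) (v ++ w).
Proof.
move=> /asboolP uv; apply/asboolP; elim: uv => {u v}.
- move=> _ _ [u v x b]; rewrite -!catA !cat_cons.
  exact/word_equivalent_step/Cancel.
- move=> u; exact: word_equivalent_refl.
- move=> u v _; exact: word_equivalent_sym.
- move=> u v t _ uv _; exact: word_equivalent_trans.
Qed.

Lemma word_inv_cat (u v : word) : word_inv (u ++ v) = word_inv v ++ word_inv u.
Proof. by rewrite /word_inv map_cat rev_cat. Qed.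

Lemma word_invK : involutive word_inv.
Proof.
move=> u; rewrite /word_inv map_rev revK -map_comp -[RHS]map_id.
by apply: eq_map => -[x b] /=; rewrite negbK.
Qed.

Lemma word_equiv_inv (u v : word) :
  word_equiv u v -> word_equiv (word_inv u) (word_inv v).
Proof.
move=> /asboolP uv; apply/asboolP; elim: uv => {u v}.
- move=> _ _ [u v x b]; rewrite !word_inv_cat.
  rewrite (word_inv_cat [:: (x, b); (x, ~~ b)] v) -catA {2}/word_inv /= negbK.
  exact/word_equivalent_step/Cancel.
- move=> u; exact: word_equivalent_refl.
- move=> u v _; exact: word_equivalent_sym.
- move=> u v t _ uv _; exact: word_equivalent_trans.
Qed.

Lemma word_catV (u : word) : word_equiv (u ++ word_inv u) [::].
Proof.
elim/last_ind: u => [|u [x b] IHu]; first exact: word_equiv_refl.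
apply: word_equiv_trans IHu; apply/asboolP.
rewrite -cats1 word_inv_cat -catA /=; exact/word_equivalent_step/Cancel.
Qed.

Lemma free_group_mulE (u v : word) :
  free_group_mul (\pi_free_group u) (\pi_free_group v) =
  \pi_free_group (u ++ v).
Proof.
apply/free_group_eqP; apply: (@word_equiv_trans (u ++ repr (\pi_free_group v))).
  exact/word_equiv_catr/repr_free_group.
exact/word_equiv_catl/repr_free_group.
Qed.

Lemma free_group_invE (u : word) :
  free_group_inv (\pi_free_group u) = \pi_free_group (word_inv u).
Proof. exact/free_group_eqP/word_equiv_inv/repr_free_group. Qed.

Let free_group_mulA : associative free_group_mul.
Proof.
elim/quotW=> u; elim/quotW=> v; elim/quotW=> w.
rewrite (free_group_mulE v w) (free_group_mulE u (v ++ w)).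
by rewrite (free_group_mulE u v) (free_group_mulE (u ++ v) w) catA.
Qed.

Let free_group_1mul : left_id free_group_one free_group_mul.
Proof. by elim/quotW=> u; rewrite free_group_mulE. Qed.

Let free_group_mul1 : right_id free_group_one free_group_mul.
Proof. by elim/quotW=> u; rewrite free_group_mulE cats0. Qed.

Let free_group_mulV :
  right_inverse free_group_one free_group_inv free_group_mul.
Proof.
elim/quotW=> u; rewrite free_group_invE free_group_mulE.
exact/free_group_eqP/word_catV.
Qed.

Let free_group_Vmul :
  left_inverse free_group_one free_group_inv free_group_mul.
Proof.
elim/quotW=> u; rewrite free_group_invE free_group_mulE.
by apply/free_group_eqP; rewrite -{2}(word_invK u); exact: word_catV.
Qed.

HB.instance Definition _ :=
  isGroup.Build free_group free_group_mulA free_group_1mul free_group_mul1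
    free_group_Vmul free_group_mulV.

End free_group.

Definition group_isomorphic (G H : groupType) : Prop :=
  exists f : {multiplicative G -> H}, bijective f.

Section affine_configurations.
Context (R : realType) (n : nat).

(* An [n]-tuple of points of the plane is the matrix whose rows are the points,
   and plane vectors are row vectors. *)
Definition affine_span (p : 'M[R]_(n, 2)) : set 'rV[R]_2 :=
  [set c *m p | c in [set c : 'rV[R]_n | \sum_(i < n) c 0 i = 1]].

Definition config_set : set 'M[R]_(n, 2) :=
  [set p : 'M[R]_(n, 2) |
    injective (fun i => row i p) /\ affine_span p = [set: 'rV[R]_2]].

Definition config : Type := set_type config_set.

HB.instance Definition _ := Topological.copy config (set_type config_set).

Definition orientation_preserving_affine (f : 'rV[R]_2 -> 'rV[R]_2) : Prop :=
  exists (A : 'M[R]_2) (b : 'rV[R]_2),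
    0 < \det A /\ forall u, f u = u *m A + b.

Definition same_orbit (p q : config) : bool :=
  `[< exists f, orientation_preserving_affine f /\
        forall i, row i (\val q) = f (row i (\val p)) >].

Lemma same_orbit_refl : reflexive same_orbit.
Proof.
move=> p; apply/asboolP; exists id; split=> //.
by exists 1%:M, 0; rewrite det1 ltr01; split=> // u; rewrite mulmx1 addr0.
Qed.

Lemma same_orbit_sym : symmetric same_orbit.
Proof.
suff S p q : same_orbit p q -> same_orbit q p.
  by move=> p q; apply/idP/idP; exact: S.
move=> /asboolP[f [[A [b [A0 fE]]] pq]]; apply/asboolP.
have uA : A \in unitmx by rewrite unitmxE unitfE gt_eqF.
exists (fun u => u *m invmx A - b *m invmx A); split.
  by exists (invmx A), (- (b *m invmx A)); rewrite det_inv invr_gt0.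
by move=> i; rewrite pq fE mulmxDl mulmxK // addrK.
Qed.

Lemma same_orbit_trans : transitive same_orbit.
Proof.
move=> q p r /asboolP[f [[A [b [A0 fE]]] pq]] /asboolP[g [[B [c [B0 gE]]] qr]].
apply/asboolP; exists (g \o f); split; last by move=> i; rewrite qr pq.
exists (A *m B), (b *m B + c); rewrite det_mulmx mulr_gt0 //; split=> // u.
by rewrite /= gE fE mulmxDl mulmxA addrA.
Qed.

Canonical same_orbit_equiv :=
  EquivRel same_orbit same_orbit_refl same_orbit_sym same_orbit_trans.

Definition affine_config : Type := quotient_topology {eq_quot same_orbit}.

HB.instance Definition _ :=
  Topological.copy affine_config (quotient_topology {eq_quot same_orbit}).
HB.instance Definition _ :=
  Quotient.copy affine_config (quotient_topology {eq_quot same_orbit}).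

End affine_configurations.

(* Main.v *)
From HB Require Import structures.
Require Import Defs.
From mathcomp Require Import all_boot all_order all_algebra.
From mathcomp Require Import generic_quotient.
From mathcomp Require Import all_classical all_reals all_analysis.
From mathcomp Require Import homotopy lra ring.
From Corelib Require Setoid Morphisms.

Set Implicit Arguments.
Unset Strict Implicit.
Unset Printing Implicit Defensive.

Import Order.TTheory GRing.Theory Num.Theory.
Import numFieldNormedType.Exports.

Local Open Scope classical_set_scope.
Local Open Scope ring_scope.
Local Open Scope quotient_scope.

(** Translate the first point of a configuration to the origin and record the
    other three as the columns of a 2 x 3 matrix of rank two.  Up to
    orientation-preserving linear maps of the plane such a matrix is determined
    by the direction of the cross product of its rows, the normal vector of its
    row space ([normal_orbit], [frame_of_normal]).  Two of the four points
    coincide exactly when this vector lies on one of six lines through the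
    origin of R^3 ([normal_punctured], [frame_injective]).  So the configuration
    space is the sphere minus twelve points, presented here as R^3 minus six
    lines modulo positive scaling; [normal_direction] and [frame_config] are the
    two directions of this identification.

    Project R^3 to a plane along an axis chosen so that the twelve half-lines
    have distinct shadows.  Removing from R^3 the points which lie on or below
    a half-line leaves a set that is star-shaped about the upper pole of the
    axis, and removing the points on or above them leaves one that is
    star-shaped about the lower pole ([slit_star]).  These two open sets cover
    the complement of the six lines ([slit_cover]), and they meet in the
    preimages of the twelve open sectors between consecutive shadows, which are
    convex and disjoint ([slit_gap], [gap_convex]).  Pulled back to the
    configuration space they are two simply connected charts ([star_simple])
    meeting in twelve path-connected pieces.

    A space covered by two simply connected open charts with n + 1 path-connected
    overlaps has the fundamental group of the graph with two vertices and n + 1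
    edges, which is free of rank n ([pi1_two_charts]).  The isomorphism sends a
    loop to the word of overlaps it crosses ([transport]).  This word is unique
    because a path lifts to the covering space glued from copies of the charts
    ([transport_unique]), and it is a homotopy invariant because the same
    crossings remain valid for all nearby paths ([transport_near],
    [transport_homotopy]).  Conversely a loop is recovered from its word since
    paths inside a chart are determined up to homotopy by their endpoints
    ([transport_class]). *)

(** * Interval induction *)

Lemma pair_continuous (X Y Z : topologicalType) (f : X -> Y) (g : X -> Z) :
  continuous f -> continuous g -> continuous (fun x => (f x, g x)).
Proof.
move=> cf cg x; apply: (@cvg_pair X Y Z (nbhs x) (nbhs (f x)) (nbhs (g x))).
  exact: cf.
exact: cg.
Qed.

(** An additive property of intervals that holds near every point holds on the
    whole interval: the set of endpoints reached from [A] contains its supremum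
    and the supremum cannot be smaller than [B].  All compactness and
    connectedness arguments about paths below are instances. *)
Lemma interval_induction (R : realType) (A B : R) (P : R -> R -> Prop) :
    A <= B ->
    (forall a b c, A <= a -> a <= b -> b <= c -> c <= B ->
       P a b -> P b c -> P a c) ->
    (forall t, A <= t <= B -> exists2 e : R, 0 < e &
       forall a b, A <= a -> a <= t -> t <= b -> b <= B ->
         t - e < a -> b < t + e -> P a b) ->
  P A B.
Proof.
move=> AB Ptr Ploc.
pose S : set R := [set t | A <= t <= B /\ P A t].
have SA : S A.
  split; first by rewrite lexx.
  have [|e e0 He] := Ploc A; first by rewrite lexx.
  by apply: He => //; lra.
have Sub : has_sup S.
  by split; [exists A | exists B => t [/andP[]]].
have leS t : S t -> t <= sup S by move=> St; exact: ub_le_sup Sub.2 _ St.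
have As : A <= sup S by exact: leS.
have sB : sup S <= B by apply: ge_sup; [exists A | move=> t [/andP[]]].
have [|e e0 He] := Ploc (sup S); first by rewrite As.
have [t [/andP[At tB] PAt] ts] := sup_adherent e0 Sub.
have PAs b : sup S <= b -> b <= B -> b < sup S + e -> P A b.
  move=> sb bB be.
  have ts' : t <= sup S by apply: leS; split => //; rewrite At.
  apply: (Ptr A t b) => //; first exact: le_trans sb.
  by apply: He => //.
have [sB'|sB'] := ltP (sup S) B; last first.
  by apply: PAs => //; rewrite ?(le_lt_trans sB') //; lra.
have [b [sb bB be]] : exists b, [/\ sup S < b, b <= B & b < sup S + e].
  exists (Num.min B (sup S + e / 2)).
  by split; rewrite ?lt_min ?ge_min ?gt_min ?sB' ?lexx //; lra.
have : b <= sup S.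
  by apply: leS; split; [rewrite bB (le_trans As (ltW sb))|apply: PAs => //; exact: ltW].
by rewrite leNgt sb.
Qed.

(** * Transport of chart values along a path *)

Section transport.
Context {R : realType} {T : topologicalType} {J : Type} {G : groupType}.
Context (U : bool -> set T) (V : J -> set T) (g : J -> G).
Hypothesis U_open : forall k, open (U k).
Hypothesis V_open : forall j, open (V j).
Hypothesis U_cover : forall y, U false y \/ U true y.
Hypothesis UV : forall y, U false y /\ U true y <-> exists j, V j y.
Hypothesis V_disjoint : forall i j y, V i y -> V j y -> i = j.

(** [transport f a k b l x]: following [f] from time [a] in chart [k] to time [b]
    in chart [l], with changes of chart at points of the overlaps [V j], the
    product of the crossings is [x]; an overlap counts [g j] from chart [false]
    to chart [true] and its inverse the other way.  The subdivision and the
    sequence of charts are not part of the relation, so it is preserved by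
    perturbations of [f]. *)
Inductive transport (f : R -> T) : R -> bool -> R -> bool -> G -> Prop :=
| transport_stay a b k : a <= b -> (forall t, a <= t <= b -> U k (f t)) ->
    transport f a k b k 1%g
| transport_cross a j : V j (f a) -> transport f a false a true (g j)
| transport_back a j : V j (f a) -> transport f a true a false (g j)^-1%g
| transport_trans a b c k l m x y :
    transport f a k b l x -> transport f b l c m y ->
    transport f a k c m (x * y)%g.

Lemma V_U j k y : V j y -> U k y.
Proof.
by move=> Vy; have [] := (UV y).2 (ex_intro _ j Vy); case: k.
Qed.

Lemma transport_le f a k b l x : transport f a k b l x -> a <= b.
Proof. by elim=> // {a b k l x} a b c k l m x y _ ab _; exact: le_trans. Qed.

Lemma transport_ends f a k b l x :
  transport f a k b l x -> U k (f a) /\ U l (f b).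
Proof.
elim=> {a b k l x} [a b k ab H|a j Vj|a j Vj|a b c k l m x y _ [? _] _ [_ ?]] //.
- by split; apply: H; rewrite lexx ab.
- by split; exact: V_U Vj.
- by split; exact: V_U Vj.
Qed.

Lemma chart_ex y : exists k, U k y.
Proof. by case: (U_cover y); [exists false|exists true]. Qed.

Lemma transport_switch f a k l : U k (f a) -> U l (f a) ->
  exists x, transport f a k a l x.
Proof.
have stay m : U m (f a) -> exists x, transport f a m a m x.
  move=> Um; exists 1%g; apply: transport_stay => // t.
  by rewrite -eq_le => /eqP <-.
move: k l => [] [] Uk Ul; try exact: stay.
- have [j Vj] := (UV _).1 (conj Ul Uk); exists (g j)^-1%g.
  exact: transport_back.
- have [j Vj] := (UV _).1 (conj Uk Ul); exists (g j).
  exact: transport_cross.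
Qed.

Lemma open_near_ball (Q : set T) (f : R -> T) t : continuous f -> open Q ->
  Q (f t) -> exists2 e : R, 0 < e & forall s, t - e < s < t + e -> Q (f s).
Proof.
move=> cf oQ Qt.
have /nbhs_ballP[e /= e0 He] : nbhs t (f @^-1` Q).
  by apply: cf; exact: open_nbhs_nbhs.
by exists e => // s Hs; apply: He; rewrite /ball /= ltr_norml; lra.
Qed.

Lemma transport_ex (f : R -> T) (a b : R) k l : continuous f -> a <= b ->
  U k (f a) -> U l (f b) -> exists x, transport f a k b l x.
Proof.
move=> cf ab; move: k l; pattern a, b; apply: (interval_induction ab) => {ab}.
  move=> {}a b' {}b _ _ _ _ IH1 IH2 k l Uk Ul.
  have [m Um] := chart_ex (f b').
  have [x Hx] := IH1 _ _ Uk Um; have [y Hy] := IH2 _ _ Um Ul.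
  by exists (x * y)%g; exact: transport_trans Hx Hy.
move=> t _; have [m Um] := chart_ex (f t).
have [e e0 He] := open_near_ball cf (U_open m) Um.
exists e => // a' b' _ at' tb' _ ea eb k l Uk Ul.
have Hm s : a' <= s <= b' -> U m (f s) by move=> Hs; apply: He; lra.
have Uma : U m (f a') by apply: Hm; lra.
have Umb : U m (f b') by apply: Hm; lra.
have [x Hx] := transport_switch Uk Uma.
have [y Hy] := transport_switch Umb Ul.
exists (x * (1 * y))%g; apply: (transport_trans Hx); apply: transport_trans Hy.
by apply: transport_stay => //; lra.
Qed.

(** The transition function of the covering; the value 1 outside the overlaps is
    arbitrary. *)
Definition gap_value (y : T) : G :=
  if pselect (exists j, V j y) is left h then g (projT1 (cid h)) else 1%g.

Lemma gap_valueE j y : V j y -> gap_value y = g j.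
Proof.
move=> Vj; rewrite /gap_value; case: pselect => [h|[]]; last by exists j.
by rewrite (V_disjoint (projT2 (cid h)) Vj).
Qed.

Lemma gap_value_const (f : R -> T) (a b : R) : continuous f -> a <= b ->
  (forall t, a <= t <= b -> exists j, V j (f t)) ->
  gap_value (f a) = gap_value (f b).
Proof.
move=> cf ab; pattern a, b; apply: (interval_induction ab) => {ab}.
  move=> {}a b' {}b _ ab' bb' _ IH1 IH2 H.
  by rewrite IH1 ?IH2 // => t Ht; apply: H; lra.
move=> t tab; have [[j Vj]|NV] := pselect (exists j, V j (f t)); last first.
  by exists 1 => // a' b' _ at' tb' _ _ _ H; case: NV; apply: H; lra.
have [e e0 He] := open_near_ball cf (V_open j) Vj.
exists e => // a' b' _ at' tb' _ ea eb _.
by rewrite !(@gap_valueE j) //; apply: He; lra.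
Qed.

(** A lift of [f] to the covering space with fibre [G] whose transition function
    is given by [g]: [c t k] is the fibre coordinate at time [t] in chart [k],
    meaningful only if [f t] lies in [U k].  Constancy on intervals that stay in
    one chart replaces continuity for a topology on the covering space. *)
Definition is_lift (f : R -> T) (a b : R) (c : R -> bool -> G) : Prop :=
  (forall s t k, a <= s -> s <= t -> t <= b ->
     (forall r, s <= r <= t -> U k (f r)) -> c s k = c t k) /\
  (forall t j, a <= t <= b -> V j (f t) -> c t true = (c t false * g j)%g).

Lemma lift_agree f a b a' b' c d t k l :
    is_lift f a b c -> is_lift f a' b' d -> a <= t <= b -> a' <= t <= b' ->
    U k (f t) -> U l (f t) ->
  c t k = d t k -> c t l = d t l.
Proof.
move=> [_ Lc] [_ Ld] tab tab' Uk Ul.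
have [->//|kl] := eqVneq k l.
have [j Vj] : exists j, V j (f t).
  by apply/UV; case: k l Uk Ul kl => [] [].
move: (Lc _ _ tab Vj) (Ld _ _ tab' Vj).
case: k l {Uk Ul} kl => [] [] //= _ cE dE; last by rewrite cE dE => ->.
by rewrite cE dE => /mulIg.
Qed.

(** Near a time where [f] lies in chart [k] the lift is constant in chart [k];
    two lifts on adjacent intervals are glued after a left translation by [G]
    that makes them agree at the common time. *)
Lemma lift_ex (f : R -> T) (a b : R) : continuous f -> a <= b -> exists c, is_lift f a b c.
Proof.
move=> cf ab; pattern a, b; apply: (interval_induction ab) => {ab}.
  move=> {}a m {}b _ am mb _ [c Lc] [d Ld].
  have [k Uk] := chart_ex (f m).
  pose d' t l := (c m k * (d m k)^-1 * d t l)%g.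
  have Ld' : is_lift f m b d'.
    split=> [s t l ms st tb H|t j tmb Vj]; rewrite /d'.
      by rewrite (Ld.1 s t l).
    by rewrite (Ld.2 t j) // mulgA.
  have cd l : U l (f m) -> c m l = d' m l.
    move=> Ul; apply: (lift_agree Lc Ld' _ _ Uk Ul); rewrite ?lexx ?am ?mb //.
    by rewrite /d' -mulgA mulVg mulg1.
  exists (fun t l => if t <= m then c t l else d' t l); split.
    move=> s t l as_ st tb H.
    case: (leP s m) => sm; case: (leP t m) => tm.
    - by apply: Lc.1.
    - rewrite (Lc.1 s m) //; last by move=> r Hr; apply: H; lra.
      rewrite cd; last by apply: H; lra.
      by apply: Ld'.1 => //; [lra|move=> r Hr; apply: H; lra].
    - by move: (le_trans st tm); rewrite leNgt sm.
    - by apply: Ld'.1 => //; lra.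
  move=> t j tab Vj; case: (leP t m) => tm.
    by apply: Lc.2 => //; lra.
  by apply: Ld'.2 => //; lra.
move=> t _; have [k Uk] := chart_ex (f t).
have [e e0 He] := open_near_ball cf (U_open k) Uk.
exists e => // {}a {}b _ at' tb' _ ea eb.
have Hk s : a <= s <= b -> U k (f s) by move=> Hs; apply: He; lra.
exists (fun t l => if l == k then 1%g
                  else if k then (gap_value (f t))^-1%g else gap_value (f t)).
split=> [s u l as_ su ub H|u j uab Vj].
  case: eqP => // /eqP lk; rewrite (gap_value_const cf su) // => r Hr.
  apply/UV; have := H _ Hr; have /Hk : a <= r <= b by lra.
  by case: k l lk {Uk He Hk H} => [] [].
by rewrite !(gap_valueE Vj); case: k {Uk He Hk}; rewrite /= ?mulVg ?mul1g.
Qed.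

Lemma transport_lift f A B c a k b l x : is_lift f A B c ->
  transport f a k b l x -> A <= a -> b <= B -> c b l = (c a k * x)%g.
Proof.
move=> Lc; elim=> {a b k l x} [a b k ab H Aa bB|a j Vj Aa aB|a j Vj Aa aB|].
- by rewrite mulg1; apply/esym/Lc.1.
- by apply: Lc.2 => //; lra.
- by rewrite (Lc.2 a j) ?mulgK //; lra.
move=> a b d k l m x y T1 IH1 T2 IH2 Aa dB.
have ab := transport_le T1; have bd := transport_le T2.
by rewrite IH2 ?IH1 ?mulgA //; lra.
Qed.

(** A lift turns transport into the ratio of its end values, whatever
    subdivision was used. *)
Lemma transport_unique f a k b l x y : continuous f ->
  transport f a k b l x -> transport f a k b l y -> x = y.
Proof.
move=> cf Tx Ty; have [c Lc] := lift_ex cf (transport_le Tx).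
have := transport_lift Lc Tx (lexx _) (lexx _).
by rewrite (transport_lift Lc Ty) // => /mulgI.
Qed.

Lemma tube (Q : set T) (F : R * R -> T) (s0 a b : R) : continuous F -> open Q ->
  a <= b -> (forall t, a <= t <= b -> Q (F (t, s0))) ->
  \forall s \near s0, forall t, a <= t <= b -> Q (F (t, s)).
Proof.
move=> cF oQ ab; pattern a, b; apply: (interval_induction ab) => {ab}.
  move=> {}a m {}b _ am mb _ IH1 IH2 H.
  have H1 : forall t, a <= t <= m -> Q (F (t, s0)) by move=> t Ht; apply: H; lra.
  have H2 : forall t, m <= t <= b -> Q (F (t, s0)) by move=> t Ht; apply: H; lra.
  apply: filterS2 (IH1 H1) (IH2 H2) => s K1 K2 t /andP[at_ tb].
  by have [tm|/ltW tm] := leP t m; [apply: K1|apply: K2]; rewrite ?at_ ?tm.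
move=> t _; have [Qt|NQ] := pselect (Q (F (t, s0))); last first.
  by exists 1 => // {}a {}b _ at_ tb _ _ _ H; case: NQ; apply: H; rewrite at_.
have : nbhs (t, s0) (F @^-1` Q) by apply: cF; exact: open_nbhs_nbhs.
move=> [[A B] /= [/nbhs_ballP[e /= e0 eA] nB] AB].
exists e => // {}a {}b _ at_ tb _ ea eb _; apply: filterS nB => s Bs r Hr.
by apply: (AB (r, s)); split => //=; apply: eA; rewrite /ball /= ltr_norml; lra.
Qed.

Lemma transport_near (F : R * R -> T) (s0 a b : R) k l x : continuous F ->
  transport (fun t => F (t, s0)) a k b l x ->
  \forall s \near s0, transport (fun t => F (t, s)) a k b l x.
Proof.
move=> cF.
have near_V j c : V j (F (c, s0)) -> \forall s \near s0, V j (F (c, s)).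
  move=> Vc; apply: filterS (tube (a := c) (b := c) cF (V_open j) _ _) => //.
    by move=> s; apply; rewrite lexx.
  by move=> t; rewrite -eq_le => /eqP <-.
elim=> {a b k l x} [a b k ab H|a j /near_V|a j /near_V|].
- apply: filterS (tube cF (U_open k) ab H) => s; exact: transport_stay.
- by apply: filterS => s; exact: transport_cross.
- by apply: filterS => s; exact: transport_back.
move=> a b c k l m x y _ IH1 _ IH2; apply: filterS2 IH1 IH2 => s.
exact: transport_trans.
Qed.

(** Near each parameter a transport along one curve of the family is also one
    along its neighbours, so by uniqueness the transported value is locally
    constant in the parameter. *)
Lemma transport_homotopy (F : R * R -> T) (a b s0 s1 : R) k l x : continuous F ->
    a <= b -> s0 <= s1 ->
    (forall s, s0 <= s <= s1 -> U k (F (a, s)) /\ U l (F (b, s))) ->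
  transport (fun t => F (t, s0)) a k b l x ->
  transport (fun t => F (t, s1)) a k b l x.
Proof.
move=> cF ab s01.
have cFs s : continuous (fun t => F (t, s)).
  move=> t; apply: (@continuous_comp _ _ _ (fun t => (t, s)) F); last exact: cF.
  by apply: pair_continuous => {}t; [exact: cvg_id|exact: cvg_cst].
move: x; pattern s0, s1; apply: (interval_induction s01) => {s01}.
  move=> {}s0 s {}s1 _ ? ? _ IH1 IH2 x H Tx.
  apply: IH2; last apply: IH1 => //.
    by move=> r Hr; apply: H; lra.
  by move=> r Hr; apply: H; lra.
move=> s _; have [[Ul Uk]|N] := pselect (U k (F (a, s)) /\ U l (F (b, s))); last first.
  by exists 1 => // {}s0 {}s1 _ ? ? _ _ _ x H; case: N; apply: H; lra.
have [y /(transport_near cF)] := transport_ex (cFs s) ab Ul Uk.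
move=> /nbhs_ballP[e /= e0 He].
exists e => // {}s0 {}s1 _ ? ? _ ? ? x _ Tx.
have Ty r : s - e < r < s + e -> transport (fun t => F (t, r)) a k b l y.
  by move=> Hr; apply: He; rewrite /ball /= ltr_norml; lra.
have xy : x = y.
  by apply: (transport_unique (cFs s0) Tx); apply: Ty; lra.
by rewrite xy; apply: Ty; lra.
Qed.

Lemma transport_affine f (h : R -> T) (u v : R) a k b l x : 0 < u ->
    (forall t, a <= t <= b -> h (u * t + v) = f t) ->
  transport f a k b l x -> transport h (u * a + v) k (u * b + v) l x.
Proof.
move=> u0 + Tx; elim: Tx => {a b k l x} [a b k ab H hf|a j Vj hf|a j Vj hf|a].
- apply: transport_stay; first by rewrite lerD2r ler_pM2l.
  move=> t /andP[t1 t2]; rewrite (_ : t = u * ((t - v) / u) + v); last first.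
    by rewrite mulrC divfK ?subrK // gt_eqF.
  have Ht : a <= (t - v) / u <= b.
    by rewrite ler_pdivlMr // ler_pdivrMr // mulrC lerBrDr t1 mulrC lerBlDr.
  by rewrite hf //; exact: H.
- by apply: transport_cross; rewrite hf ?lexx.
- by apply: transport_back; rewrite hf ?lexx.
move=> b c k l m x y T1 IH1 T2 IH2 hf.
have ? := transport_le T1; have ? := transport_le T2.
apply: transport_trans (IH1 _) (IH2 _) => t Ht; apply: hf; lra.
Qed.

End transport.

(** * Homomorphisms out of free groups *)

Section free_group_lift.
Context (X : choiceType) (H : groupType) (h : X -> H).

Definition free_gen (y : X) : free_group X :=
  \pi_(free_group X) ([:: (y, true)] : word X).

Definition eval_letter (l : X * bool) : H :=
  if l.2 then h l.1 else (h l.1)^-1%g.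

Definition eval_word (u : word X) : H :=
  foldr (fun l y => (eval_letter l * y)%g) 1%g u.

Lemma eval_word_cat u v : eval_word (u ++ v) = (eval_word u * eval_word v)%g.
Proof. by elim: u => [|l u /= ->]; rewrite ?mul1g ?mulgA. Qed.

Lemma eval_word_equiv u v : word_equiv u v -> eval_word u = eval_word v.
Proof.
move=> /asboolP; elim=> {u v} // [_ _ [u v y b]|u v w _ -> _ -> //].
rewrite !eval_word_cat; congr (_ * _)%g => /=; rewrite mulgA -[RHS]mul1g.
by congr (_ * _)%g; case: b; rewrite /eval_letter /= ?mulgV ?mulVg.
Qed.

Definition free_lift (a : free_group X) : H := eval_word (repr a).

Lemma free_liftE u : free_lift (\pi_(free_group X) u) = eval_word u.
Proof. exact/eval_word_equiv/repr_free_group. Qed.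

Lemma free_lift1 : free_lift 1%g = 1%g.
Proof. exact: free_liftE. Qed.

Lemma free_liftM a b : free_lift (a * b)%g = (free_lift a * free_lift b)%g.
Proof.
elim/quotW: a => u; elim/quotW: b => v.
by rewrite [X in free_lift X]free_group_mulE !free_liftE eval_word_cat.
Qed.

Lemma free_liftV a : free_lift a^-1%g = (free_lift a)^-1%g.
Proof.
by apply: (mulIg (free_lift a)); rewrite -free_liftM !mulVg free_lift1.
Qed.

Lemma free_lift_gen y : free_lift (free_gen y) = h y.
Proof. by rewrite free_liftE /= mulg1. Qed.

End free_group_lift.

Lemma free_group_ind (X : choiceType) (P : free_group X -> Prop) :
    P 1%g -> (forall y a, P a -> P (free_gen y * a)%g) ->
    (forall y a, P a -> P ((free_gen y)^-1 * a)%g) ->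
  forall a, P a.
Proof.
move=> P1 PM PV; elim/quotW; elim=> [|[y b] u IHu]; first exact: P1.
rewrite -(free_group_mulE [:: (y, b)] u); case: b; first exact: PM.
rewrite (_ : \pi_(free_group X) _ = (free_gen y)^-1%g); first exact: PV.
by rewrite [RHS]free_group_invE.
Qed.

(** * Calculus of homotopy classes of paths *)

Section real_valued.
Context {R : realType} {X : topologicalType}.
Implicit Types f g : X -> R.

Lemma add_fun_continuous f g :
  continuous f -> continuous g -> continuous (fun x => f x + g x).
Proof. by move=> cf cg x; exact: (continuousD (cf x) (cg x)). Qed.

Lemma sub_fun_continuous f g :
  continuous f -> continuous g -> continuous (fun x => f x - g x).
Proof. by move=> cf cg x; exact: (continuousB (cf x) (cg x)). Qed.

Lemma mul_fun_continuous f g :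
  continuous f -> continuous g -> continuous (fun x => f x * g x).
Proof. by move=> cf cg x; exact: (continuousM (cf x) (cg x)). Qed.

Lemma const_fun_continuous (r : R) : continuous (fun _ : X => r).
Proof. exact: cst_continuous. Qed.

End real_valued.

Section homotopy_calculus.
Context {R : realType} {T : topologicalType}.
Local Notation I := (unit_itv R).
Implicit Types (x y z : T) (f : R -> T).

(** A [Prop]-valued version of the relation, so that it supports rewriting. *)
Definition homotopic (x y : T) (p q : {path I from x to y}) : Prop :=
  path_homotopic p q.

Lemma homotopic_refl x y (p : {path I from x to y}) : homotopic p p.
Proof. exact: path_homotopic_refl. Qed.

#[global] Instance homotopic_equivalence x y : RelationClasses.Equivalence (@homotopic x y).
Proof.
split; first exact: path_homotopic_refl.
  by move=> p q; rewrite /homotopic path_homotopic_sym.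
by move=> q p r pq qr; exact: path_homotopic_trans pq qr.
Qed.

#[global] Instance path_concat_proper x y z :
  Morphisms.Proper (Morphisms.respectful (@homotopic x y)
    (Morphisms.respectful (@homotopic y z) (@homotopic x z)))
    (@path_concat R T x y z).
Proof. by move=> p p' pp' q q' qq'; exact: concat_homotopic. Qed.

Lemma concatA x y z w (p : {path I from x to y}) (q : {path I from y to z})
    (r : {path I from z to w}) :
  homotopic (path_concat p (path_concat q r))
            (path_concat (path_concat p q) r).
Proof. exact: path_concatA. Qed.

Lemma concat_const x y (p : {path I from x to y}) :
  homotopic (path_concat p (path_const y)) p.
Proof. exact: path_concat1. Qed.

Lemma const_concat x y (p : {path I from x to y}) :
  homotopic (path_concat (path_const x) p) p.
Proof. exact: path_1concat. Qed.

Lemma concat_cancel x y z (p : {path I from x to y}) (q : {path I from y to z}) :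
  homotopic (path_concat (path_reverse p) (path_concat p q)) q.
Proof.
rewrite concatA -[X in homotopic _ X]const_concat.
by apply: concat_homotopic; [exact: path_Vconcat|exact: homotopic_refl].
Qed.

(** The straight-line homotopy between the two parametrizations. *)
Lemma reparam_real_homotopic (f : R -> T) (phi psi : I -> R) x y
    (p q : {path I from x to y}) :
    continuous f -> continuous phi -> continuous psi ->
    phi zero = psi zero -> phi one = psi one ->
    p =1 f \o phi -> q =1 f \o psi -> homotopic p q.
Proof.
move=> cf cphi cpsi e0 e1 pE qE; apply/asboolP.
exists (fun ts : I * I => f ((1 - \val ts.2) * phi ts.1 + \val ts.2 * psi ts.1)).
have cv : continuous (fun ts : I * I => \val ts.2 : R).
  by apply: val_comp_continuous => ts; exact: cvg_snd.
have cfst (u : I -> R) : continuous u -> continuous (fun ts : I * I => u ts.1).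
  by move=> cu ts; apply: continuous_comp; [exact: cvg_fst|exact: cu].
split=> [ts|t|t|s|s].
- apply: (@continuous_comp _ _ _ (fun ts : I * I =>
    (1 - \val ts.2) * phi ts.1 + \val ts.2 * psi ts.1) f); last exact: cf.
  apply: add_fun_continuous; apply: mul_fun_continuous => //.
  - by apply: sub_fun_continuous => //; exact: const_fun_continuous.
  - exact: cfst.
  - exact: cfst.
- by rewrite val_zero subr0 mul1r mul0r addr0 pE.
- by rewrite val_one subrr mul1r mul0r add0r qE.
- by rewrite /= -e0 -mulrDl subrK mul1r -[f _]/((f \o phi) zero) -pE path_zero.
- by rewrite /= -e1 -mulrDl subrK mul1r -[f _]/((f \o phi) one) -pE path_one.
Qed.

Lemma segment_continuous (f : R -> T) a b : continuous f ->
  continuous (fun t : I => f (a + (b - a) * \val t)).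
Proof.
move=> cf t.
apply: (@continuous_comp _ _ _ (fun t : I => a + (b - a) * \val t) f);
  last exact: cf.
apply: add_fun_continuous; first exact: const_fun_continuous.
by apply: mul_fun_continuous; [exact: const_fun_continuous|exact: val_continuous].
Qed.

Lemma segment_zero (f : R -> T) a b : f (a + (b - a) * \val (zero : I)) = f a.
Proof. by rewrite val_zero mulr0 addr0. Qed.

Lemma segment_one (f : R -> T) a b : f (a + (b - a) * \val (one : I)) = f b.
Proof. by rewrite val_one mulr1 addrC subrK. Qed.

Definition segment (f : R -> T) (cf : continuous f) a b :
    {path I from f a to f b} :=
  mk_path (@segment_continuous f a b cf) (segment_zero f a b) (segment_one f a b).

(** The endpoints [x] and [y] are left independent of [f a] and [f b], to which
    they are only provably equal; this lets a loop be compared with the curve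
    obtained by clamping its parameter. *)
Definition traces (f : R -> T) (a b : R) x y (r : {path I from x to y}) : Prop :=
  forall t, r t = f (a + (b - a) * \val t).

Lemma segment_traces f (cf : continuous f) (a b : R) : traces f a b (segment cf a b).
Proof. by []. Qed.

Lemma traces_concat f a b c x y z (r : {path I from x to z})
    (p : {path I from x to y}) (q : {path I from y to z}) :
    continuous f -> traces f a c r -> traces f a b p -> traces f b c q ->
  homotopic r (path_concat p q).
Proof.
move=> cf rE pE qE; symmetry.
pose phi (t : I) := if \val t <= 2^-1 :> R then a + (b - a) * (2 * \val t)
                    else b + (c - b) * (2 * \val t - 1).
have cal (u v u' v' : R) :
    continuous (fun t : I => u + v * (u' * \val t + v')).
  apply: add_fun_continuous; first exact: const_fun_continuous.
  apply: mul_fun_continuous; first exact: const_fun_continuous.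
  apply: add_fun_continuous; last exact: const_fun_continuous.
  by apply: mul_fun_continuous; [exact: const_fun_continuous|exact: val_continuous].
apply: (@reparam_real_homotopic f phi (fun t => a + (c - a) * \val t)) => //.
- apply: pasting.
  + exact: val_continuous.
  + by have := cal a (b - a) 2 0; under eq_fun do rewrite addr0.
  + exact: cal.
  + by move=> t ->; lra.
- by have := cal a (c - a) 1 0; under eq_fun do rewrite mul1r addr0.
- by rewrite /phi val_zero ifT; lra.
- rewrite /phi val_one ifF; last by apply/negbTE; rewrite -ltNge; lra.
  lra.
move=> t /=; have t0 := unit_itv_ge0 t; have t1 := unit_itv_le1 t.
rewrite path_concatE /phi; case: leP => t2.
  by rewrite pE clampE //; lra.
by rewrite qE clampE //; lra.
Qed.

Lemma path_clamp_continuous x y (p : {path I from x to y}) :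
  continuous (fun t : R => p (clamp t)).
Proof.
by move=> t; apply: continuous_comp; [exact: clamp_continuous|exact: cts_fun].
Qed.

Lemma path_traces x y (p : {path I from x to y}) :
  traces (fun t => p (clamp t)) 0 1 p.
Proof. by move=> t; rewrite subr0 mul1r add0r clampK. Qed.

Lemma concat_in (Q : set T) x y z (p : {path I from x to y})
    (q : {path I from y to z}) :
  (forall t, Q (p t)) -> (forall t, Q (q t)) -> forall t, Q (path_concat p q t).
Proof. by move=> Hp Hq t; rewrite path_concatE; case: ifP. Qed.

End homotopy_calculus.
#[global] Hint Resolve homotopic_refl : core.

(** * The fundamental group of a union of two simply connected charts *)

Section two_charts.
Context {R : realType} {T : topologicalType} (n : nat).
Local Notation I := (unit_itv R).
Context (U : bool -> set T) (V : 'I_n.+1 -> set T) (x : T).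
Hypothesis U_open : forall k, open (U k).
Hypothesis V_open : forall j, open (V j).
Hypothesis U_cover : forall y, U false y \/ U true y.
Hypothesis UV : forall y, U false y /\ U true y <-> exists j, V j y.
Hypothesis V_disjoint : forall i j y, V i y -> V j y -> i = j.
Hypothesis U_joined : forall k y z, U k y -> U k z ->
  exists p : {path I from y to z}, forall t, U k (p t).
Hypothesis V_joined : forall j y z, V j y -> V j z ->
  exists p : {path I from y to z}, forall t, V j (p t).
Hypothesis U_simple : forall k y z (p q : {path I from y to z}),
  (forall t, U k (p t)) -> (forall t, U k (q t)) -> homotopic p q.
Hypothesis V_nonempty : forall j, exists y, V j y.
Hypothesis x_U : U false x.

Local Notation F := (free_group 'I_n).
Local Notation P := (fundamental_group R x).

(** Overlap 0 plays the role of a spanning tree of the graph with two vertices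
    (the charts) and one edge for each overlap, so its generator is trivial. *)
Definition gap_gen (j : 'I_n.+1) : F :=
  if unlift ord0 j is Some i then free_gen i else 1%g.

Local Notation tr := (transport U V gap_gen).

Let V_in j k y : V j y -> U k y.
Proof. exact: V_U UV j k y. Qed.

Lemma monodromy_ex (p : {path I from x to x}) :
  exists a, tr (fun t => p (clamp t)) 0 false 1 false a.
Proof.
apply: (transport_ex _ U_open U_cover UV) => //.
- exact: path_clamp_continuous.
- by rewrite -zeroE path_zero.
- by rewrite -oneE path_one.
Qed.

Definition monodromy (p : {path I from x to x}) : F :=
  projT1 (cid (monodromy_ex p)).

Lemma monodromyP (p : {path I from x to x}) a :
  tr (fun t => p (clamp t)) 0 false 1 false a <-> monodromy p = a.
Proof.
have M : tr (fun t => p (clamp t)) 0 false 1 false (monodromy p).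
  by rewrite /monodromy; case: cid.
split=> [Ta|<-//].
apply: (transport_unique U_open V_open U_cover UV V_disjoint _ M Ta).
exact: path_clamp_continuous.
Qed.

(** The base point stays in chart [false] all along the homotopy, so transport
    is constant in the homotopy parameter. *)
Lemma monodromy_homotopic p q : homotopic p q -> monodromy p = monodromy q.
Proof.
move=> /asboolP[H [cH H0 H1 Hx Hy]].
apply/esym/monodromyP; have := (monodromyP p _).2 erefl.
pose K (ts : R * R) := H (clamp ts.1, clamp ts.2).
have cK : continuous K.
  move=> ts; apply: (@continuous_comp _ _ _
    (fun ts : R * R => (clamp ts.1, clamp ts.2)) H); last exact: cH.
  exact: (pair_map_continuous (@clamp_continuous R) (@clamp_continuous R)).
rewrite (_ : (fun t => p (clamp t)) = fun t => K (t, 0)); last first.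
  by apply/funext => t; rewrite /K /= -zeroE H0.
rewrite (_ : (fun t => q (clamp t)) = fun t => K (t, 1)); last first.
  by apply/funext => t; rewrite /K /= -oneE H1.
apply: (transport_homotopy U_open V_open U_cover UV V_disjoint cK) => // s _.
by rewrite /K /= -zeroE Hx -oneE Hy.
Qed.

Lemma transport_concat y z w (p : {path I from y to z}) (q : {path I from z to w})
    k l m a b :
  tr (fun t => p (clamp t)) 0 k 1 l a -> tr (fun t => q (clamp t)) 0 l 1 m b ->
  tr (fun t => path_concat p q (clamp t)) 0 k 1 m (a * b)%g.
Proof.
move=> Ta Tb; apply: (@transport_trans _ _ _ _ _ _ _ _ _ 2^-1 _ _ l).
  have -> : 0 = 2^-1 * 0 + 0 :> R by lra.
  rewrite [X in tr _ _ _ X](_ : _ = 2^-1 * 1 + 0 :> R); last lra.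
  apply: transport_affine Ta; first by lra.
  by move=> t Ht; rewrite path_concatE clampE ?ifT; [congr (p (clamp _))|..]; lra.
rewrite [X in tr _ X](_ : _ = 2^-1 * 0 + 2^-1 :> R); last lra.
rewrite [X in tr _ _ _ X](_ : _ = 2^-1 * 1 + 2^-1 :> R); last lra.
apply: transport_affine Tb; first by lra.
move=> t Ht; rewrite path_concatE clampE; last by lra.
case: leP => t2; last by congr (q (clamp _)); lra.
have -> : t = 0 by lra.
rewrite (_ : 2 * _ = 1); last lra.
by rewrite -zeroE -oneE path_zero path_one.
Qed.

Lemma transport_in y z (p : {path I from y to z}) k :
  (forall t, U k (p t)) -> tr (fun t => p (clamp t)) 0 k 1 k 1%g.
Proof. by move=> Up; apply: transport_stay. Qed.

Lemma monodromy_concat p q :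
  monodromy (path_concat p q) = (monodromy p * monodromy q)%g.
Proof.
by apply/monodromyP; apply: transport_concat; apply/monodromyP.
Qed.

(** The base point of chart [true] is a point [y0] of overlap 0, reached from [x]
    inside chart [false] by a path [p0]. *)
Lemma base_gap_ex : exists y0 : T, V ord0 y0 /\
  exists p : {path I from x to y0}, forall t, U false (p t).
Proof.
by have [y Vy] := V_nonempty ord0; exists y; split=> //; apply/U_joined/V_in/Vy.
Qed.

Let y0 := projT1 (cid base_gap_ex).
Let p0 := projT1 (cid (projT2 (cid base_gap_ex)).2).

Let V_y0 : V ord0 y0.
Proof. exact: (projT2 (cid base_gap_ex)).1. Qed.

Let U_p0 t : U false (p0 t).
Proof. exact: (projT2 (cid (projT2 (cid base_gap_ex)).2)). Qed.

Lemma gap_ex j : exists y, [/\ V j y,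
  exists p : {path I from x to y}, forall t, U false (p t) &
  exists p : {path I from y0 to y}, forall t, U true (p t)].
Proof.
have [y Vy] := V_nonempty j; exists y; split=> //; apply: U_joined => //.
- exact: V_in Vy.
- exact: V_in V_y0.
- exact: V_in Vy.
Qed.

Lemma gap_loop_ex j : exists y (p : {path I from x to y})
    (q : {path I from y0 to y}),
  [/\ V j y, forall t, U false (p t) & forall t, U true (q t)].
Proof. by have [y [Vy [p Up] [q Uq]]] := gap_ex j; exists y, p, q. Qed.

Let gy j := projT1 (cid (gap_loop_ex j)).
Let gp j := projT1 (cid (projT2 (cid (gap_loop_ex j)))).
Let gq j := projT1 (cid (projT2 (cid (projT2 (cid (gap_loop_ex j)))))).
Let gP j : [/\ V j (gy j), forall t, U false (gp j t) & forall t, U true (gq j t)].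
Proof. exact: (projT2 (cid (projT2 (cid (projT2 (cid (gap_loop_ex j))))))). Qed.

(** The loop leaves through overlap [j], travels in chart [true], and returns
    through overlap 0. *)
Definition gap_loop j : {path I from x to x} :=
  path_concat (gp j) (path_concat (path_reverse (gq j)) (path_reverse p0)).

Lemma reverse_in (Q : set T) y z (p : {path I from y to z}) :
  (forall t, Q (p t)) -> forall t, Q (path_reverse p t).
Proof. by move=> Qp t; rewrite path_reverseE. Qed.

Lemma monodromy_gap_loop j : monodromy (gap_loop j) = gap_gen j.
Proof.
have [Vj Up Uq] := gP j; apply/monodromyP.
rewrite -[gap_gen j]mul1g; apply: transport_concat; first exact: transport_in.
rewrite -[gap_gen j]mulg1; apply: transport_concat; last first.
  by apply: transport_in; apply: reverse_in; exact: U_p0.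
have E0 : path_reverse (gq j) (clamp 0) = gy j by rewrite -zeroE path_zero.
have E1 : path_reverse (gq j) (clamp 1) = y0 by rewrite -oneE path_one.
rewrite -[gap_gen j]mulg1.
apply: (@transport_trans _ _ _ _ _ _ _ _ _ 0 _ _ true).
  by apply: transport_cross; rewrite E0.
rewrite -[1%g]mul1g; apply: (@transport_trans _ _ _ _ _ _ _ _ _ 1 _ _ true).
  by apply: transport_in; exact: reverse_in.
(* The way back crosses overlap 0, which counts for 1. *)
have -> : 1%g = (gap_gen ord0)^-1%g by rewrite /gap_gen unlift_none invg1.
by apply: transport_back; rewrite E1.
Qed.

Local Notation class := \pi_(fundamental_group R x).

Lemma classP (p q : {path I from x to x}) : class p = class q <-> homotopic p q.
Proof. by split=> /pi1_eqP. Qed.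

Lemma class_concat (p q : {path I from x to x}) :
  class (path_concat p q) = (class p * class q)%g.
Proof. by rewrite -pi1_mulE. Qed.

Definition word_class : F -> P :=
  @free_lift _ P (fun i => class (gap_loop (lift ord0 i))).

Definition chart_base (k : bool) : T := if k then y0 else x.

Definition chart_path (k : bool) : {path I from x to chart_base k} :=
  match k return {path I from x to chart_base k} with
  | true => p0
  | false => path_const x
  end.

Lemma chart_base_U k : U k (chart_base k).
Proof. by case: k => //=; exact: V_in V_y0. Qed.

(** Paths from [x] to [y] in the class singled out by chart [k]: first the fixed
    path to the base point of the chart, then a path inside the chart.  As the
    chart is simply connected, its points have exactly one such class. *)
Definition within_chart k y (p : {path I from x to y}) : Prop :=
  exists2 q : {path I from chart_base k to y},
    forall t, U k (q t) & homotopic p (path_concat (chart_path k) q).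

Lemma within_chart_ex k y : U k y ->
  exists p : {path I from x to y}, within_chart k p.
Proof.
move=> Uy; have [q Uq] := U_joined (chart_base_U k) Uy.
by exists (path_concat (chart_path k) q), q.
Qed.

Lemma within_chart_step k y z (p : {path I from x to y})
    (q : {path I from x to z}) (r : {path I from y to z}) :
    within_chart k p -> within_chart k q -> (forall t, U k (r t)) ->
  homotopic (path_concat p r) q.
Proof.
move=> [p' Up pE] [q' Uq qE] Ur; rewrite pE qE -concatA.
apply: concat_homotopic; first exact: homotopic_refl.
by apply: (U_simple (k := k)) => //; exact: concat_in.
Qed.

(** At a point of overlap [j] the classes singled out by the two charts differ
    by the loop of that overlap. *)
Lemma within_chart_cross j y (p q : {path I from x to y}) : V j y ->
    within_chart false p -> within_chart true q ->
  homotopic p (path_concat (gap_loop j) q).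
Proof.
move=> Vy Wp [q' Uq qE]; have [Vj Ujp Ujq] := gP j.
have [r Vr] := V_joined Vj Vy.
have Ur k t : U k (r t) by exact: V_in (Vr t).
have q'E : homotopic q' (path_concat (gq j) r).
  by apply: (U_simple (k := true)) => //; exact: concat_in.
rewrite qE q'E /gap_loop -!concatA concat_cancel concat_cancel.
symmetry; apply: (within_chart_step (k := false)) => //.
by exists (gp j) => //; rewrite const_concat.
Qed.

Lemma gap_loop0 : class (gap_loop ord0) = 1%g.
Proof.
apply/classP; have [V0 Up0 Uq0] := gP ord0.
have [r Vr] := V_joined V0 V_y0.
have E : homotopic (path_reverse (gq ord0)) r.
  apply: (U_simple (k := true)) => //; first exact: reverse_in.
  by move=> t; exact: V_in (Vr t).
rewrite /gap_loop E; apply: (U_simple (k := false)) => //.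
apply: concat_in => //; apply: concat_in; last exact: reverse_in.
by move=> t; exact: V_in (Vr t).
Qed.

Lemma word_class_gap j : word_class (gap_gen j) = class (gap_loop j).
Proof.
rewrite /gap_gen; case: unliftP => [i ->|->]; first exact: free_lift_gen.
by rewrite gap_loop0; exact: free_lift1.
Qed.

(** A piece of a curve, preceded by the path singled out by its first chart, is
    homotopic to the path singled out by its last chart preceded by the loop
    spelled by the transported word.  Induction on the transport: inside a chart
    this is simple connectedness, at a crossing it is [within_chart_cross]. *)
Lemma transport_class f a b k l u : continuous f -> tr f a k b l u ->
  forall y z (r : {path I from y to z}) (p : {path I from x to y})
    (q : {path I from x to z}) (w : {path I from x to x}),
    traces f a b r -> within_chart k p -> within_chart l q ->
    class w = word_class u ->
  homotopic (path_concat p r) (path_concat w q).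
Proof.
move=> cf; elim=> {a b k l u} [a b k ab H|a j Vj|a j Vj|].
- move=> y z r p q w rE Wp Wq.
  rewrite [word_class _]free_lift1 => /classP wE.
  rewrite wE const_concat; apply: within_chart_step Wp Wq _ => t.
  rewrite rE; apply: H; have t0 := unit_itv_ge0 t; have t1 := unit_itv_le1 t.
  have := mulr_ge0 (_ : 0 <= b - a) t0.
  have := mulr_ge0 (_ : 0 <= b - a) (_ : 0 <= 1 - \val t).
  by rewrite mulrBr mulr1 !subr_ge0 => /(_ ab t1) ? /(_ ab) ?; lra.
- move=> y z r p q w rE Wp Wq.
  have rC t : r t = f a by rewrite rE subrr mul0r addr0.
  have ya : y = f a by rewrite -(rC zero) path_zero.
  have za : z = f a by rewrite -(rC one) path_one.
  subst y z; have -> : r = path_const (f a) by apply/path_eqP.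
  rewrite word_class_gap => /classP wE; rewrite wE concat_const.
  exact: within_chart_cross.
- move=> y z r p q w rE Wp Wq.
  have rC t : r t = f a by rewrite rE subrr mul0r addr0.
  have ya : y = f a by rewrite -(rC zero) path_zero.
  have za : z = f a by rewrite -(rC one) path_one.
  subst y z; have -> : r = path_const (f a) by apply/path_eqP.
  rewrite [word_class _]free_liftV -/(word_class _) word_class_gap => wE.
  have {wE} wE : homotopic w (path_reverse (gap_loop j)).
    by apply/classP; rewrite wE -[RHS]pi1_invE.
  rewrite wE concat_const (within_chart_cross Vj Wq Wp).
  by rewrite concat_cancel.
move=> a b c k l m u v T1 IH1 T2 IH2 y z r p q w rE Wp Wq.
rewrite [word_class _]free_liftM -!/(word_class _).
have [w1 w1E] : exists w1 : {path I from x to x}, class w1 = word_class u.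
  by exists (repr (word_class u)); rewrite reprK.
have [w2 w2E] : exists w2 : {path I from x to x}, class w2 = word_class v.
  by exists (repr (word_class v)); rewrite reprK.
rewrite -w1E -w2E -class_concat => /classP wE; rewrite wE.
have ya : y = f a by rewrite -(path_zero (s := r)) rE segment_zero.
have zc : z = f c by rewrite -(path_one (s := r)) rE segment_one.
subst y z.
have [_ Ub] := transport_ends UV T1.
have [s Ws] := within_chart_ex Ub.
rewrite (traces_concat cf rE (segment_traces cf a b) (segment_traces cf b c)).
rewrite concatA (IH1 _ _ _ p s w1 (segment_traces cf a b)) // -!concatA.
by rewrite (IH2 _ _ _ s q w2 (segment_traces cf b c)).
Qed.

Lemma word_class_monodromy p : word_class (monodromy p) = class p.
Proof.
have [w wE] : exists w : {path I from x to x}, class w = word_class (monodromy p).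
  by exists (repr (word_class (monodromy p))); rewrite reprK.
have W : within_chart false (path_const x).
  by exists (path_const x) => //=; rewrite const_concat.
rewrite -wE; apply/classP; symmetry.
have := transport_class (@path_clamp_continuous _ _ _ _ p) ((monodromyP p _).2 erefl)
  (path_traces p) W W wE.
by rewrite const_concat concat_const.
Qed.

Definition pi1_monodromy (a : P) : F := monodromy (repr a).

Lemma pi1_monodromyE p : pi1_monodromy (class p) = monodromy p.
Proof. exact/monodromy_homotopic/repr_pi1. Qed.

Lemma pi1_monodromyM : {morph pi1_monodromy : a b / (a * b)%g}.
Proof.
by move=> a b; rewrite pi1_monodromyE monodromy_concat.
Qed.

HB.instance Definition _ :=
  isMultiplicative.Build P F pi1_monodromy pi1_monodromyM.

Lemma pi1_monodromyK : cancel pi1_monodromy word_class.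
Proof.
by elim/quotW=> p; rewrite pi1_monodromyE word_class_monodromy.
Qed.

Lemma word_classK : cancel word_class pi1_monodromy.
Proof.
have M1 : pi1_monodromy 1%g = 1%g.
  by apply: (mulgI (pi1_monodromy 1%g)); rewrite -pi1_monodromyM !mulg1.
have MV a : pi1_monodromy a^-1%g = (pi1_monodromy a)^-1%g.
  by apply: (mulIg (pi1_monodromy a)); rewrite -pi1_monodromyM !mulVg.
have Mgen i : pi1_monodromy (word_class (free_gen i)) = free_gen i.
  rewrite [word_class _]free_lift_gen pi1_monodromyE monodromy_gap_loop.
  by rewrite /gap_gen liftK.
apply: free_group_ind => [|i a IH|i a IH].
- by rewrite [word_class _]free_lift1.
- by rewrite [word_class _]free_liftM -!/(word_class _) pi1_monodromyM Mgen IH.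
- rewrite [word_class _]free_liftM free_liftV -!/(word_class _).
  by rewrite pi1_monodromyM MV Mgen IH.
Qed.

Theorem pi1_two_charts : group_isomorphic P F.
Proof.
exists pi1_monodromy; exists word_class.
  exact: pi1_monodromyK.
exact: word_classK.
Qed.

End two_charts.

(** When the base point lies only in chart [true], the two charts are
    exchanged. *)
Lemma pi1_two_charts_any_base (R : realType) (T : topologicalType) (n : nat)
    (U : bool -> set T) (V : 'I_n.+1 -> set T) (x : T) :
    (forall k, open (U k)) -> (forall j, open (V j)) ->
    (forall y, U false y \/ U true y) ->
    (forall y, U false y /\ U true y <-> exists j, V j y) ->
    (forall i j y, V i y -> V j y -> i = j) ->
    (forall k y z, U k y -> U k z ->
       exists p : {path unit_itv R from y to z}, forall t, U k (p t)) ->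
    (forall j y z, V j y -> V j z ->
       exists p : {path unit_itv R from y to z}, forall t, V j (p t)) ->
    (forall k y z (p q : {path unit_itv R from y to z}),
       (forall t, U k (p t)) -> (forall t, U k (q t)) -> homotopic p q) ->
    (forall j, exists y, V j y) ->
  group_isomorphic (fundamental_group R x) (free_group 'I_n).
Proof.
move=> oU oV UUT UV dV jU jV sU neV.
have [Ux|Ux] := UUT x.
  by apply: (@pi1_two_charts R T n U V x).
apply: (@pi1_two_charts R T n (fun k => U (~~ k)) V x) => //=.
- by move=> y; have [] := UUT y; [right|left].
- by move=> y; rewrite -UV; split=> -[].
- by move=> k y z; exact: jU.
- by move=> k y z p q; exact: sU.
Qed.

(** * Star-shaped cones pulled back along a radial chart *)

(** The map [phi] identifies [X] with the cone [Y] modulo positive scaling, with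
    [sigma] as inverse.  A homotopy in [X] is obtained by moving [phi] along
    segments inside a subcone [C] of [Y] and applying [sigma]. *)
Section cone_chart.
Context {R : realType} {W : normedModType R} {X : topologicalType}.
Local Notation I := (unit_itv R).
Context (Y : set W) (phi : X -> W) (sigma : W -> X).
Hypothesis phi_continuous : continuous phi.
Hypothesis phiK : cancel phi sigma.
Hypothesis sigmaK : forall v, Y v -> exists2 c : R, 0 < c & phi (sigma v) = c *: v.
Hypothesis sigma_continuous : forall (Z : topologicalType) (f : Z -> W),
  continuous f -> (forall z, Y (f z)) -> continuous (sigma \o f).
Context (C : set W).
Hypothesis C_Y : C `<=` Y.
Hypothesis C_cone : forall (c : R) v, 0 < c -> C v -> C (c *: v).

Lemma phi_sigma_in v : C v -> C (phi (sigma v)).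
Proof. by move=> Cv; have [c c0 ->] := sigmaK (C_Y Cv); exact: C_cone. Qed.

Lemma combination_continuous (Z : topologicalType) (u : Z -> R) (f g : Z -> W) :
  continuous u -> continuous f -> continuous g ->
  continuous (fun z => (1 - u z) *: f z + u z *: g z).
Proof.
move=> cu cf cg z.
have cu1 : continuous (fun z => 1 - u z).
  by apply: sub_fun_continuous => //; exact: const_fun_continuous.
exact: (continuousD (continuousZ (cu1 z) (cf z)) (continuousZ (cu z) (cg z))).
Qed.

Definition segment_in (v w : W) : Prop :=
  forall s : R, 0 <= s <= 1 -> C ((1 - s) *: v + s *: w).

Lemma segment_joined y z : segment_in (phi y) (phi z) ->
  exists p : {path I from y to z}, forall t, C (phi (p t)).
Proof.
move=> Cyz.
pose f (t : I) := sigma ((1 - \val t) *: phi y + \val t *: phi z).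
have Cf (t : I) : C ((1 - \val t) *: phi y + \val t *: phi z).
  by apply: Cyz; rewrite unit_itv_ge0 unit_itv_le1.
have cf : continuous f.
  apply: (@sigma_continuous _ (fun t : I => (1 - \val t) *: phi y + \val t *: phi z)).
    by apply: combination_continuous; [exact: val_continuous|exact: cst_continuous..].
  by move=> t; apply: C_Y.
have f0 : f zero = y by rewrite /f val_zero subr0 scale1r scale0r addr0.
have f1 : f one = z by rewrite /f val_one subrr scale1r scale0r add0r.
exists (mk_path cf f0 f1) => t; exact: phi_sigma_in.
Qed.

Context (N : W).
Hypothesis CN : C N.
Hypothesis C_star : forall v, C v -> forall s : R, 0 <= s <= 1 ->
  C ((1 - s) *: v + s *: N).

(** The image of [sigma N] under [phi] is only a positive multiple of [N], so a
    point of the segment towards it is a multiple [d] of a point of the segment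
    towards [N]. *)
Lemma star_joined y z : C (phi y) -> C (phi z) ->
  exists p : {path I from y to z}, forall t, C (phi (p t)).
Proof.
have to_center u : C (phi u) ->
    exists p : {path I from u to sigma N}, forall t, C (phi (p t)).
  move=> Cu; apply: segment_joined => s s01.
  have [c c0 ->] := sigmaK (C_Y CN).
  have [->|s1] := eqVneq s 0.
    by rewrite subr0 scale1r scale0r addr0.
  have sc0 : 0 < s * c by apply: mulr_gt0 => //; lra.
  pose d := (1 - s) + s * c; have d0 : 0 < d by rewrite /d; lra.
  have dE : d * (s * c / d) = s * c by rewrite mulrC divfK // gt_eqF.
  have -> : (1 - s) *: phi u + s *: (c *: N) =
      d *: ((1 - s * c / d) *: phi u + (s * c / d) *: N).
    by rewrite scalerDr !scalerA mulrBr mulr1 dE /d addrK.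
  apply: C_cone => //; apply: C_star => //.
  by rewrite ler_pdivlMr // ler_pdivrMr // mul0r mul1r /d; lra.
move=> Cy Cz; have [p Cp] := to_center y Cy; have [q Cq] := to_center z Cz.
exists (path_concat p (path_reverse q)); apply: (@concat_in _ _ (phi @^-1` C)) => // t.
by rewrite path_reverseE.
Qed.

(** A weight that vanishes at both ends of the unit interval and is 1 on its
    middle third. *)
Let ramp (t : R) : R := Num.min 1 (Num.min (3 * t + 0) (- 3 * t + 3)).

Let ramp0 : ramp 0 = 0.
Proof.
by rewrite /ramp (@min_l _ _ (3 * 0 + 0)) ?min_r ?mulr0 ?addr0 //; lra.
Qed.

Let ramp1 : ramp 1 = 0.
Proof. by rewrite /ramp (@min_r _ _ (3 * 1 + 0)) ?min_r; lra. Qed.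

Let ramp_in (t : I) : 0 <= ramp (\val t) <= 1.
Proof.
have t0 := unit_itv_ge0 t; have t1 := unit_itv_le1 t.
by rewrite /ramp !le_min ge_min lexx; lra.
Qed.

(** Reparametrize the path by [psi], which makes it rest at its endpoints during
    the first and last thirds of the time, and drag it to the centre [N] with
    weight [ramp].  In the middle third the result is [N], and in the outer
    thirds it depends only on the endpoints; so any two paths with the same
    endpoints are dragged to the same path. *)
Lemma star_simple y z (p q : {path I from y to z}) :
  (forall t, C (phi (p t))) -> (forall t, C (phi (q t))) -> homotopic p q.
Proof.
pose psi (t : I) : I := clamp (3 * \val t + (-1)).
have psi0 (t : I) : \val t <= 3^-1 -> psi t = zero.
  by move=> ?; apply: clamp_le0; lra.
have psi1 (t : I) : 1 - 3^-1 <= \val t -> psi t = one.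
  by move=> ?; apply: clamp_ge1; lra.
have cpsi : continuous psi by apply: clamp_comp_continuous; exact: affine_continuous.
have cramp : continuous (fun t : I => ramp (\val t)).
  rewrite /ramp; apply: Defs.min_continuous; first exact: cst_continuous.
  by apply: Defs.min_continuous; exact: affine_continuous.
pose K (r : {path I from y to z}) (t s : I) : W :=
  (1 - \val s * ramp (\val t)) *: phi (r (psi t)) +
  (\val s * ramp (\val t)) *: N.
pose H (r : {path I from y to z}) (ts : I * I) : W := K r ts.1 ts.2.
have key (r : {path I from y to z}) : (forall t, C (phi (r t))) ->
    exists2 r' : {path I from y to z}, homotopic r r' &
      forall t, r' t = sigma (K r t one).
  move=> Cr.
  have CH ts : C (H r ts).
    apply: C_star => //; have /andP[? ?] := ramp_in ts.1.
    have := unit_itv_ge0 ts.2; have := unit_itv_le1 ts.2 => ? ?.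
    by rewrite mulr_ge0 //= mulr_ile1.
  have cH : continuous (H r).
    apply: combination_continuous.
    - apply: mul_fun_continuous.
        by apply: val_comp_continuous => ts; exact: cvg_snd.
      move=> ts; apply: (@continuous_comp _ _ _ fst (fun t : I => ramp (\val t))).
        exact: cvg_fst.
      exact: cramp.
    - move=> ts.
      apply: (@continuous_comp _ _ _ (fun ts : I * I => r (psi ts.1)) phi);
        last exact: phi_continuous.
      apply: (@continuous_comp _ _ _ (fun ts : I * I => psi ts.1) r);
        last exact: cts_fun.
      by apply: (@continuous_comp _ _ _ fst psi); [exact: cvg_fst|exact: cpsi].
    - exact: cst_continuous.
  have csH : continuous (sigma \o H r).
    exact: (sigma_continuous cH (fun ts => C_Y (CH ts))).
  have cps s : continuous (fun t => (sigma \o H r) (t, s)).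
    move=> t; apply: (@continuous_comp _ _ _ (fun t => (t, s)) (sigma \o H r));
      last exact: csH.
    by apply: pair_continuous => {}t; [exact: cvg_id|exact: cst_continuous].
  have Hy s : (sigma \o H r) (zero, s) = y.
    rewrite -[LHS]/(sigma (K r zero s)) /K val_zero psi0 ?val_zero; last by lra.
    by rewrite ramp0 mulr0 subr0 scale1r scale0r addr0 path_zero phiK.
  have Hz s : (sigma \o H r) (one, s) = z.
    rewrite -[LHS]/(sigma (K r one s)) /K val_one psi1 ?val_one; last by lra.
    by rewrite ramp1 mulr0 subr0 scale1r scale0r addr0 path_one phiK.
  have cr' : continuous (r \o psi).
    by move=> t; apply: continuous_comp; [exact: cpsi|exact: cts_fun].
  have r'0 : (r \o psi) zero = y.
    by rewrite /= psi0 ?val_zero ?path_zero //; lra.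
  have r'1 : (r \o psi) one = z.
    by rewrite /= psi1 ?val_one ?path_one //; lra.
  exists (mk_path (cps one) (Hy one) (Hz one)) => //.
  transitivity (mk_path cr' r'0 r'1 : {path I from y to z}).
    apply: (@reparam_homotopic _ _ _ _ r id psi) => //.
    - exact: cts_fun.
    - by move=> t; exact: cvg_id.
    - by rewrite psi0 // val_zero; lra.
    - by rewrite psi1 // val_one; lra.
  apply/asboolP; exists (sigma \o H r); split=> // t.
  by rewrite -[LHS]/(sigma (K r t zero)) /K val_zero !mul0r subr0 scale1r
    scale0r addr0 phiK.
move=> /key[p' pp' p'E] /key[q' qq' q'E].
rewrite pp' qq' (_ : p' = q') //; apply/path_eqP => t; rewrite p'E q'E.
rewrite /K val_one mul1r.
have [t1|t1] := leP (\val t) (3^-1 : R); first by rewrite psi0 // !path_zero.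
have [t2|t2] := leP (1 - 3^-1) (\val t : R); first by rewrite psi1 // !path_one.
rewrite (_ : ramp _ = 1) ?subrr ?scale0r // /ramp min_l // le_min; lra.
Qed.

End cone_chart.

(** * Twelve rays in the plane *)

Section rays.
Context {R : realType}.
Local Notation R3 := (R * R * R)%type.
Implicit Types (d v : R3) (a b : R).

(** The twelve half-lines in counterclockwise order of their shadows: the first
    two coordinates of [ray i] give the shadow of a direction vector, the third
    one its height.  The half-line [i + 6] is opposite to [i], and entry 12
    repeats entry 0 to close up the last sector. *)
Definition ray (i : nat) : R3 :=
  nth 0 [:: (1, 0, 0); (2, 2, 1); (2, 3, 1); (1, 3, 1); (0, 1, 0); (-1, 1, 0);
            (-1, 0, 0); (-2, -2, -1); (-2, -3, -1); (-1, -3, -1); (0, -1, 0);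
            (1, -1, 0); (1, 0, 0)] i.

Definition cross d a b : R := d.1.1 * b - d.1.2 * a.
Definition dot d a b : R := d.1.1 * a + d.1.2 * b.
Definition on_ray d a b : Prop := cross d a b = 0 /\ 0 <= dot d a b.

(** The open sector between two consecutive shadows; its angle is less than two
    right angles, so two strict linear inequalities describe it. *)
Definition sector (j : nat) a b : Prop :=
  0 < cross (ray j) a b /\ cross (ray j.+1) a b < 0.

Lemma ray_sqr_gt0 i : (i < 12)%N -> 0 < dot (ray i) (ray i).1.1 (ray i).1.2.
Proof. by move: i; do 12![case=> [_|]; first by rewrite /dot /=; lra]. Qed.

Lemma ray_disjoint i j a b : (i < 12)%N -> (j < 12)%N -> i != j ->
  on_ray (ray i) a b -> on_ray (ray j) a b -> a = 0 /\ b = 0.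
Proof.
rewrite /on_ray /cross /dot.
move: i; do 12?[case]; rewrite //=; move: j; do 12?[case]; rewrite //= => *; lra.
Qed.

Lemma sector_not_ray i j a b : (i < 12)%N -> (j < 12)%N ->
  sector j a b -> ~ on_ray (ray i) a b.
Proof.
rewrite /sector /on_ray /cross /dot.
move: i; do 12?[case]; rewrite //=; move: j; do 12?[case]; rewrite //= => *; lra.
Qed.

Lemma sector_disjoint i j a b : (i < 12)%N -> (j < 12)%N ->
  sector i a b -> sector j a b -> i = j.
Proof.
rewrite /sector /cross.
move: i; do 12?[case]; rewrite //=; move: j; do 12?[case]; rewrite //= => *;
  exfalso; lra.
Qed.

(** A vector off all shadows has a definite sign against each of the first six
    directions, the other six being their opposites; the first change of sign
    locates the sector. *)
Lemma sector_ex a b : (forall i, (i < 12)%N -> ~ on_ray (ray i) a b) ->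
  exists2 j, (j < 12)%N & sector j a b.
Proof.
move=> nray.
have c_neq0 i : (i < 6)%N -> cross (ray i) a b != 0.
  move=> i6; apply/eqP => c0.
  have [d0|d0] := leP 0 (dot (ray i) a b).
    by apply: (nray i); [exact: leq_trans i6 _|split].
  apply: (nray (i + 6)%N); first by rewrite (ltn_add2r 6 i 6).
  move: c0 d0; rewrite /on_ray /cross /dot.
  by move: i i6; do 6?[case]; rewrite //= => *; split; lra.
have c_cases i : (i < 6)%N -> cross (ray i) a b < 0 \/ 0 < cross (ray i) a b.
  by move=> /c_neq0; case: ltgtP => //; [left|right].
move: (c_cases 0 isT) (c_cases 1 isT) (c_cases 2 isT) (c_cases 3 isT)
  (c_cases 4 isT) (c_cases 5 isT) => {nray c_neq0 c_cases}.
have S j : (j < 12)%N -> 0 < cross (ray j) a b -> cross (ray j.+1) a b < 0 ->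
    exists2 j, (j < 12)%N & sector j a b by exists j.
move: (S 0 isT) (S 1 isT) (S 2 isT) (S 3 isT) (S 4 isT) (S 5 isT) (S 6 isT)
  (S 7 isT) (S 8 isT) (S 9 isT) (S 10 isT) (S 11 isT) => {S}.
set Q := (exists2 j, _ & _); rewrite /cross /= => S0 S1 S2 S3 S4 S5 S6 S7 S8 S9
  S10 S11.
move=> C0 C1 C2 C3 C4 C5; case: C0 => c0.
  case: C1 => c1; last by apply: S6; lra.
  case: C2 => c2; last by apply: S7; lra.
  case: C3 => c3; last by apply: S8; lra.
  case: C4 => c4; last by apply: S9; lra.
  by case: C5 => c5; [apply: S11|apply: S10]; lra.
case: C1 => c1; first by apply: S0; lra.
case: C2 => c2; first by apply: S1; lra.
case: C3 => c3; first by apply: S2; lra.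
case: C4 => c4; first by apply: S3; lra.
by case: C5 => c5; [apply: S4|apply: S5]; lra.
Qed.

End rays.

(** * Space with six lines removed *)

Section cone_decomposition.
Context {R : realType}.
Local Notation R3 := (R * R * R)%type.
Implicit Types (d v : R3) (a b : R).

(** The projection of space to the plane along the axis spanned by (-2, -3, 1). *)
Definition shadow_x v : R := v.1.1 + 2 * v.2.
Definition shadow_y v : R := v.1.2 + 3 * v.2.

(** For i = 0, ..., 5 the line of normal vectors of the degenerate configurations
    in which the points 1, 2, resp. 3, 4, resp. 1, 4, resp. 2, 4, resp. 1, 3,
    resp. 2, 3 coincide. *)
Definition line (i : nat) : R3 :=
  nth 0 [:: (1, 0, 0); (0, -1, 1); (0, 0, 1); (-1, 0, 1); (0, 1, 0); (-1, 1, 0)] i.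

Definition punctured : set R3 :=
  [set v | forall i (s : R), (i < 6)%N -> v <> s *: line i].

Definition sign_of (k : bool) : R := if k then -1 else 1.

(** For [k = false] these are the vectors that lie above every half-line whose
    shadow contains their own shadow, and for [k = true] those that lie below.
    A vector on the axis has shadow 0, which lies on all shadows; it is kept only
    on the side of the pole.  Heights are multiplied by the squared length of
    the shadow direction to avoid a division. *)
Definition slit (k : bool) : set R3 := [set v | forall i, (i < 12)%N ->
  on_ray (ray i) (shadow_x v) (shadow_y v) ->
  sign_of k * (dot (ray i) (shadow_x v) (shadow_y v) * (ray i).2) <
    sign_of k * (v.2 * dot (ray i) (ray i).1.1 (ray i).1.2)].

Definition gap (j : nat) : set R3 :=
  [set v | sector j (shadow_x v) (shadow_y v)].

Definition pole (k : bool) : R3 :=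
  (sign_of k * -2, sign_of k * -3, sign_of k).

Lemma scale3E (s x y z : R) : s *: (x, y, z) = (s * x, s * y, s * z) :> R3.
Proof. by []. Qed.

Lemma coord_scale (s : R) v :
  ((s *: v).1.1 = s * v.1.1) * ((s *: v).1.2 = s * v.1.2) * ((s *: v).2 = s * v.2).
Proof. by []. Qed.

Lemma coord_add v w :
  ((v + w).1.1 = v.1.1 + w.1.1) * ((v + w).1.2 = v.1.2 + w.1.2) *
  ((v + w).2 = v.2 + w.2).
Proof. by []. Qed.

Lemma coord_pole k :
  ((pole k).1.1 = sign_of k * -2) * ((pole k).1.2 = sign_of k * -3) *
  ((pole k).2 = sign_of k).
Proof. by []. Qed.

Lemma slit_gap v : slit false v /\ slit true v <->
  exists2 j, (j < 12)%N & gap j v.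
Proof.
split=> [[Hf Ht]|[j j12 Sj]].
  apply: sector_ex => i i12 ri; have := Hf i i12 ri; have := Ht i i12 ri.
  by rewrite /sign_of !mulN1r !mul1r ltrN2 => /lt_trans /[apply]; rewrite ltxx.
by split=> i i12 /(sector_not_ray i12 j12 Sj).
Qed.

Lemma slit_punctured k : slit k `<=` punctured.
Proof.
move=> v Hv i s i6 vE; subst v.
have [s0|s0] := leP 0 s.
  have := Hv i (@leq_trans 6 _ 12 i6 isT).
  rewrite /on_ray /cross /dot /shadow_x /shadow_y /sign_of !coord_scale.
  move: i i6 {Hv}; do 6?[case]; rewrite //= => _; case: k => /= H; lra.
have := Hv (i + 6)%N; rewrite (ltn_add2r 6 i 6) => /(_ i6).
rewrite /on_ray /cross /dot /shadow_x /shadow_y /sign_of !coord_scale.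
move: i i6 {Hv}; do 6?[case]; rewrite //= => _; case: k => /= H; lra.
Qed.

Lemma ray_not_punctured i v : (i < 12)%N ->
  on_ray (ray i) (shadow_x v) (shadow_y v) ->
  dot (ray i) (shadow_x v) (shadow_y v) * (ray i).2 =
    v.2 * dot (ray i) (ray i).1.1 (ray i).1.2 -> ~ punctured v.
Proof.
move: v => [[x y] z] i12; rewrite /on_ray /cross /dot /shadow_x /shadow_y /=.
(* The factor is the coordinate in which the direction vector of the line is 1. *)
move=> ri hi /(_ (i %% 6)%N (nth 0 [:: x; z; z; z; y; y] (i %% 6)%N)).
case; first by rewrite ltn_mod.
move: i i12 ri hi; do 12?[case]; rewrite //= => *; rewrite /line /= scale3E;
  congr (_, _, _); lra.
Qed.

(** A vector in neither set lies on or below some half-line and on or above some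
    half-line.  If these are the same it lies on one of the six lines; otherwise
    its shadow is 0, hence so is its height. *)
Lemma slit_cover v : punctured v -> slit false v \/ slit true v.
Proof.
move=> Pv; apply: contrapT => /not_orP[].
move=> /existsNP[i /not_implyP[i12 /not_implyP[ri /negP]]].
rewrite -leNgt /sign_of !mul1r => hi.
move=> /existsNP[j /not_implyP[j12 /not_implyP[rj /negP]]].
rewrite -leNgt /sign_of !mulN1r lerN2 => hj.
have [ij|ij] := eqVneq i j.
  subst j; apply: (ray_not_punctured i12 ri) => //.
  by apply/le_anti; rewrite hj hi.
have [a0 b0] := ray_disjoint i12 j12 ij ri rj.
move: hi hj; rewrite a0 b0 /dot !mulr0 addr0 !mul0r.
rewrite pmulr_lle0 ?pmulr_lge0 ?ray_sqr_gt0 // => z1 z2.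
have z0 : v.2 = 0 by apply/le_anti/andP.
move: a0 b0; rewrite /shadow_x /shadow_y z0 !mulr0 !addr0 => x0 y0.
apply: (Pv 0%N 0) => //; rewrite scale0r.
by move: v x0 y0 z0 {Pv ri rj z1 z2} => [[x y] z] /= -> -> ->.
Qed.

Lemma shadow_combination k v (s : R) :
  [/\ shadow_x ((1 - s) *: v + s *: pole k) = (1 - s) * shadow_x v,
      shadow_y ((1 - s) *: v + s *: pole k) = (1 - s) * shadow_y v &
      ((1 - s) *: v + s *: pole k).2 = (1 - s) * v.2 + s * sign_of k].
Proof.
rewrite /shadow_x /shadow_y !coord_add !coord_scale !coord_pole.
by split; ring.
Qed.

Lemma sign_of_sqr k : sign_of k * sign_of k = 1.
Proof. by case: k; rewrite /sign_of ?mulrNN mulr1. Qed.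

(** Moving towards the pole shrinks the shadow and the height by the same factor
    and then shifts the height away from the half-line. *)
Lemma slit_star k v (s : R) : slit k v -> 0 <= s <= 1 ->
  slit k ((1 - s) *: v + s *: pole k).
Proof.
move=> Hv /andP[s0 s1] i i12.
have [-> -> ->] := shadow_combination k v s.
set a := shadow_x v; set b := shadow_y v; set n := dot _ (ray i).1.1 _.
have n0 : 0 < n by exact: ray_sqr_gt0.
rewrite /on_ray.
have -> : cross (ray i) ((1 - s) * a) ((1 - s) * b) = (1 - s) * cross (ray i) a b.
  by rewrite /cross; ring.
have -> : dot (ray i) ((1 - s) * a) ((1 - s) * b) = (1 - s) * dot (ray i) a b.
  by rewrite /dot; ring.
have -> : sign_of k * (((1 - s) * v.2 + s * sign_of k) * n) =
    (1 - s) * (sign_of k * (v.2 * n)) + s * n.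
  by ring: (sign_of_sqr k).
have -> : sign_of k * ((1 - s) * dot (ray i) a b * (ray i).2) =
    (1 - s) * (sign_of k * (dot (ray i) a b * (ray i).2)) by ring.
have [->|s1'] := eqVneq s 1; first by rewrite subrr !mul0r add0r mul1r.
have s1p : 0 < 1 - s by rewrite subr_gt0 lt_neqAle s1'.
move=> [/eqP]; rewrite mulf_eq0 (gt_eqF s1p) /= => /eqP c0.
rewrite pmulr_rge0 // => d0; have := Hv i i12 (conj c0 d0).
rewrite -(ltr_pM2l s1p) => /lt_le_trans; apply.
by rewrite lerDl mulr_ge0 // ltW.
Qed.

Lemma slit_pole k : slit k (pole k).
Proof.
move=> i i12 _; rewrite /shadow_x /shadow_y !coord_pole.
rewrite (_ : _ + 2 * _ = 0); last by ring.
rewrite (_ : _ + 3 * _ = 0); last by ring.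
rewrite {1}/dot !mulr0 addr0 !mul0r mulr0 mulrA sign_of_sqr mul1r.
exact: ray_sqr_gt0.
Qed.

Lemma shadow_scale (c : R) v :
  [/\ shadow_x (c *: v) = c * shadow_x v, shadow_y (c *: v) = c * shadow_y v &
      (c *: v).2 = c * v.2].
Proof.
by rewrite /shadow_x /shadow_y !coord_scale; split; ring.
Qed.

Lemma slit_cone k (c : R) v : 0 < c -> slit k v -> slit k (c *: v).
Proof.
move=> c0 Hv i i12; have [-> -> ->] := shadow_scale c v.
set a := shadow_x v; set b := shadow_y v; set n := dot _ (ray i).1.1 _.
rewrite /on_ray.
have -> : cross (ray i) (c * a) (c * b) = c * cross (ray i) a b.
  by rewrite /cross; ring.
have -> : dot (ray i) (c * a) (c * b) = c * dot (ray i) a b.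
  by rewrite /dot; ring.
move=> [/eqP]; rewrite mulf_eq0 (gt_eqF c0) /= => /eqP e0.
rewrite pmulr_rge0 // => d0; have := Hv i i12 (conj e0 d0).
by rewrite -(ltr_pM2l c0) -/a -/b -/n; congr (_ < _); ring.
Qed.

Lemma gap_cone j (c : R) v : 0 < c -> gap j v -> gap j (c *: v).
Proof.
move=> c0; rewrite /gap /sector /=; have [-> -> _] := shadow_scale c v.
have E i : cross (ray i) (c * shadow_x v) (c * shadow_y v) =
    c * cross (ray i) (shadow_x v) (shadow_y v) by rewrite /cross; ring.
by rewrite !E => -[? ?]; rewrite pmulr_rgt0 ?pmulr_rlt0.
Qed.

Lemma gap_convex j v w (s : R) : gap j v -> gap j w -> 0 <= s <= 1 ->
  gap j ((1 - s) *: v + s *: w).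
Proof.
rewrite /gap /sector /=; set u := _ + _.
have E i : cross (ray i) (shadow_x u) (shadow_y u) =
    (1 - s) * cross (ray i) (shadow_x v) (shadow_y v) +
    s * cross (ray i) (shadow_x w) (shadow_y w).
  by rewrite /u /cross /shadow_x /shadow_y !coord_add !coord_scale; ring.
rewrite !E => -[? ?] [? ?] /andP[s0 s1]; split; nra.
Qed.

Lemma gap_nonempty j : (j < 12)%N -> exists v, gap j v.
Proof.
move=> j12; exists ((ray j).1.1 + (ray j.+1).1.1, (ray j).1.2 + (ray j.+1).1.2, 0).
rewrite /gap /sector /cross /shadow_x /shadow_y /=.
by move: j j12; do 12?[case]; rewrite //= => _; lra.
Qed.

Lemma gap_disjoint i j v : (i < 12)%N -> (j < 12)%N -> gap i v -> gap j v -> i = j.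
Proof. exact: sector_disjoint. Qed.

Lemma shadow_x_continuous : continuous shadow_x.
Proof.
apply: add_fun_continuous.
  by move=> v; apply: (@continuous_comp _ _ _ fst fst); exact: cvg_fst.
by apply: mul_fun_continuous => v; [exact: cvg_cst|exact: cvg_snd].
Qed.

Lemma shadow_y_continuous : continuous shadow_y.
Proof.
apply: add_fun_continuous.
  by move=> v; apply: (@continuous_comp _ _ _ fst snd); [exact: cvg_fst|exact: cvg_snd].
by apply: mul_fun_continuous => v; [exact: cvg_cst|exact: cvg_snd].
Qed.

Lemma cross_continuous d : continuous (fun v => cross d (shadow_x v) (shadow_y v)).
Proof.
apply: sub_fun_continuous; apply: mul_fun_continuous.
- exact: const_fun_continuous.
- exact: shadow_y_continuous.
- exact: const_fun_continuous.
- exact: shadow_x_continuous.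
Qed.

Lemma dot_continuous d : continuous (fun v => dot d (shadow_x v) (shadow_y v)).
Proof.
apply: add_fun_continuous; apply: mul_fun_continuous.
- exact: const_fun_continuous.
- exact: shadow_x_continuous.
- exact: const_fun_continuous.
- exact: shadow_y_continuous.
Qed.

Lemma open_gt0 (f : R3 -> R) : continuous f -> open [set v | 0 < f v].
Proof.
move=> cf; apply: (@open_comp _ _ f [set r | 0 < r]); last exact: open_gt.
by move=> v _; exact: cf.
Qed.

Lemma open_lt0 (f : R3 -> R) : continuous f -> open [set v | f v < 0].
Proof.
move=> cf; apply: (@open_comp _ _ f [set r | r < 0]); last exact: open_lt.
by move=> v _; exact: cf.
Qed.

Lemma gap_open j : open (gap j).
Proof.
by apply: openI; [apply: open_gt0|apply: open_lt0]; exact: cross_continuous.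
Qed.

(** For each half-line the condition is the union of four strict inequalities:
    the shadow is on either side of the line spanned by the direction, or behind
    the origin, or the height is on the good side. *)
Lemma slit_open k : open (slit k).
Proof.
pose S i : set R3 := [set v | on_ray (ray i) (shadow_x v) (shadow_y v) ->
  sign_of k * (dot (ray i) (shadow_x v) (shadow_y v) * (ray i).2) <
    sign_of k * (v.2 * dot (ray i) (ray i).1.1 (ray i).1.2)].
have oS i : open (S i).
  pose h v := sign_of k * (v.2 * dot (ray i) (ray i).1.1 (ray i).1.2) -
    sign_of k * (dot (ray i) (shadow_x v) (shadow_y v) * (ray i).2).
  have ch : continuous h.
    apply: sub_fun_continuous; apply: mul_fun_continuous;
      try exact: const_fun_continuous; apply: mul_fun_continuous;
      try exact: const_fun_continuous; last exact: dot_continuous.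
    by move=> v; exact: cvg_snd.
  pose c v := cross (ray i) (shadow_x v) (shadow_y v).
  pose e v := dot (ray i) (shadow_x v) (shadow_y v).
  rewrite (_ : S i = [set v | 0 < h v] `|` [set v | 0 < c v] `|`
      [set v | c v < 0] `|` [set v | e v < 0]).
    apply: openU; [apply: openU; [apply: openU|]|].
    - exact: open_gt0.
    - by apply: open_gt0; exact: cross_continuous.
    - by apply: open_lt0; exact: cross_continuous.
    - by apply: open_lt0; exact: dot_continuous.
  apply/seteqP; split=> v; rewrite /S /= /h subr_gt0 -/(c v) -/(e v) /on_ray.
    move=> Sv; case: (ltgtP (c v) 0) => [|| c0]; [by left; right|by left; left; right|].
    case: (ltP (e v) 0) => [|e0]; first by right.
    by left; left; left; exact: Sv.
  case=> [[[//|]|]|]; rewrite -/(c v) -/(e v) => c0 [c1 e1]; exfalso.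
  - by move: c0; rewrite c1 ltxx.
  - by move: c0; rewrite c1 ltxx.
  - by move: c0; rewrite ltNge e1.
rewrite openE => v Hv.
have Sv (i : 'I_12) : nbhs v (S i).
  by apply: open_nbhs_nbhs; split; [exact: oS|exact: Hv].
have := @filter_forall R3 'I_12 (fun i => S i) (nbhs v) (nbhs_filter v) Sv.
by apply: filterS => w Sw i i12; exact: (Sw (Ordinal i12)).
Qed.

End cone_decomposition.

(** * The normal vector of a configuration *)

Lemma matrix_continuous (R : topologicalType) (Z : topologicalType) m n
    (f : Z -> 'M[R]_(m, n)) :
  (forall i j, continuous (fun z => f z i j)) -> continuous f.
Proof.
move=> cf z A [P nP sPA].
have nQ i : nbhs z [set w | forall j, P i j (f w i j)].
  apply: (@filter_forall Z 'I_n (fun j => [set w | P i j (f w i j)]) (nbhs z)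
    (nbhs_filter z)).
  by move=> j; exact: cf (nP i j).
have := @filter_forall Z 'I_m (fun i => [set w | forall j, P i j (f w i j)]) (nbhs z)
  (nbhs_filter z) nQ.
by apply: filterS => w Pw; exact: sPA.
Qed.

Section configurations.
Context {R : realType}.
Local Notation R3 := (R * R * R)%type.
Implicit Types (v : R3) (M : 'M[R]_(4, 2)).

Local Notation o0 := (@Ordinal 4 0 isT).
Local Notation o1 := (@Ordinal 4 1 isT).
Local Notation o2 := (@Ordinal 4 2 isT).
Local Notation o3 := (@Ordinal 4 3 isT).

Definition dx M (i : 'I_4) : R := M i ord0 - M o0 ord0.
Definition dy M (i : 'I_4) : R := M i ord_max - M o0 ord_max.

Lemma ord4_ind (P : 'I_4 -> Prop) : P o0 -> P o1 -> P o2 -> P o3 -> forall i, P i.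
Proof.
move=> P0 P1 P2 P3 [i i4].
by move: i i4; do 4?[case=> [|]] => // i4; rewrite (bool_irrelevance i4 isT).
Qed.

Lemma ord2_ind (P : 'I_2 -> Prop) : P ord0 -> P ord_max -> forall j, P j.
Proof.
move=> P0 P1 j; case: (unliftP ord0 j) => [k|] -> //.
by rewrite (ord1 k) (_ : lift _ _ = ord_max) //; apply/val_inj.
Qed.

(** The cross product of the rows of the 2 x 3 matrix of relative coordinates. *)
Definition normal M : R3 :=
  (dx M o2 * dy M o3 - dx M o3 * dy M o2, dx M o3 * dy M o1 - dx M o1 * dy M o3,
   dx M o1 * dy M o2 - dx M o2 * dy M o1).

Definition norm1 v : R := `|v.1.1| + `|v.1.2| + `|v.2|.

Lemma normal_dx M : (normal M).1.1 * dx M o1 + (normal M).1.2 * dx M o2 +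
  (normal M).2 * dx M o3 = 0.
Proof. by rewrite /normal /=; ring. Qed.

Lemma normal_dy M : (normal M).1.1 * dy M o1 + (normal M).1.2 * dy M o2 +
  (normal M).2 * dy M o3 = 0.
Proof. by rewrite /normal /=; ring. Qed.

Lemma row_eq M i j : dx M i = dx M j -> dy M i = dy M j -> row i M = row j M.
Proof.
move=> /addIr ex /addIr ey; apply/rowP => k; rewrite !mxE.
by elim/ord2_ind: k.
Qed.

(** The normal vector is orthogonal to both coordinate rows.  If it is a multiple
    of a direction vector of one of the six lines, orthogonality says that a
    difference of two points has both coordinates zero. *)
Lemma normal_punctured M : injective (fun i => row i M) -> normal M != 0 ->
  punctured (normal M).
Proof.
move=> iM M0 i s i6 E.
have s0 : s != 0 by apply: contraNneq M0 => s0; rewrite E s0 scale0r.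
have Ex := normal_dx M; have Ey := normal_dy M.
have d0 : dx M o0 = 0 /\ dy M o0 = 0 by rewrite /dx /dy !subrr.
rewrite E !coord_scale in Ex Ey.
have neq (a b : 'I_4) : a != b -> ~ (s * (dx M a - dx M b) = 0 /\ s * (dy M a - dy M b) = 0).
  move=> /eqP ab [/eqP + /eqP]; rewrite !mulf_eq0 !(negbTE s0) !subr_eq0 /=.
  by move=> /eqP ea /eqP eb; apply/ab/iM/row_eq.
move: i i6 E Ex Ey; do 6?[case]; rewrite //= => _ E Ex Ey.
- by apply: (neq o1 o0) => //; rewrite d0.1 d0.2; split; lra.
- by apply: (neq o3 o2) => //; split; lra.
- by apply: (neq o3 o0) => //; rewrite d0.1 d0.2; split; lra.
- by apply: (neq o3 o1) => //; split; lra.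
- by apply: (neq o2 o0) => //; rewrite d0.1 d0.2; split; lra.
- by apply: (neq o2 o1) => //; split; lra.
Qed.

Lemma sum4 (F : 'I_4 -> R) : \sum_i F i = F o0 + F o1 + F o2 + F o3.
Proof.
rewrite !big_ord_recl big_ord0 addr0 !addrA.
by congr (F _ + F _ + F _ + F _); apply/val_inj.
Qed.

(** If the normal vector vanished, the affine function that measures signed area
    against the first two points would vanish at all four points, hence on their
    affine span; but it does not vanish at the first point displaced by a
    quarter turn [u] of the difference of these two. *)
Lemma normal_neq0 M : injective (fun i => row i M) ->
  affine_span M = [set: 'rV[R]_2] -> normal M != 0.
Proof.
move=> iM aM; apply/eqP => E.
have [E1 [E2 E3]] : (normal M).1.1 = 0 /\ (normal M).1.2 = 0 /\ (normal M).2 = 0.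
  by rewrite E.
pose u : 'rV[R]_2 := \row_j if j == ord0 then M o0 ord0 + dy M o1
                            else M o0 ord_max - dx M o1.
have : affine_span M u by rewrite aM.
move=> [c /= c1 cu].
have ux : \sum_i c 0 i * M i ord0 = M o0 ord0 + dy M o1.
  by have /rowP/(_ ord0) := cu; rewrite !mxE.
have uy : \sum_i c 0 i * M i ord_max = M o0 ord_max - dx M o1.
  by have /rowP/(_ ord_max) := cu; rewrite !mxE.
rewrite !sum4 in c1 ux uy.
have : dx M o1 ^+ 2 + dy M o1 ^+ 2 = 0.
  move: E2 E3 c1 ux uy; rewrite /normal /dx /dy /=.
  move: (c 0 o0) (c 0 o1) (c 0 o2) (c 0 o3) => c0 c1 c2 c3.
  move: (M o0 ord0) (M o1 ord0) (M o2 ord0) (M o3 ord0).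
  move: (M o0 ord_max) (M o1 ord_max) (M o2 ord_max) (M o3 ord_max).
  move=> y0 y1 y2 y3 x0 x1 x2 x3 E2 E3 cE ux uy.
  have c0E : c0 = 1 - c1 - c2 - c3 by lra.
  have ux' : y1 - y0 = c1 * (x1 - x0) + c2 * (x2 - x0) + c3 * (x3 - x0).
    by rewrite c0E in ux; lra.
  have uy' : - (x1 - x0) = c1 * (y1 - y0) + c2 * (y2 - y0) + c3 * (y3 - y0).
    by rewrite c0E in uy; lra.
  have -> : (x1 - x0) ^+ 2 + (y1 - y0) ^+ 2 =
    (y1 - y0) * (c1 * (x1 - x0) + c2 * (x2 - x0) + c3 * (x3 - x0)) -
    (x1 - x0) * (c1 * (y1 - y0) + c2 * (y2 - y0) + c3 * (y3 - y0)).
    by rewrite -ux' -uy'; ring.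
  transitivity (- c2 * ((x1 - x0) * (y2 - y0) - (x2 - x0) * (y1 - y0)) +
    c3 * ((x3 - x0) * (y1 - y0) - (x1 - x0) * (y3 - y0))); first by ring.
  by rewrite E2 E3 !mulr0 addr0.
move=> /eqP; rewrite paddr_eq0 ?sqr_ge0 // !sqrf_eq0 => /andP[/eqP dx1 /eqP dy1].
have : o1 = o0 by apply/iM/row_eq; rewrite ?dx1 ?dy1 /dx /dy subrr.
by move/(congr1 val).
Qed.

Lemma norm1_gt0 v : v != 0 -> 0 < norm1 v.
Proof.
move: v => [[x y] z] v0; rewrite lt_neqAle addr_ge0 ?addr_ge0 // andbT eq_sym.
apply: contraNneq v0; rewrite /norm1 => /eqP.
rewrite paddr_eq0 ?addr_ge0 // paddr_eq0 // !normr_eq0 /=.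
by move=> /andP[/andP[/eqP -> /eqP ->] /eqP ->].
Qed.

(** With e = (1, 0, 0), the second coordinates of the last three points are the
    cross product w of e and v, and their first coordinates are the cross product
    of w and v.  Both are orthogonal to v and, off the line spanned by e, nonzero
    and orthogonal to each other.  No such frame of the orthogonal planes depends
    continuously on all directions v of the sphere, but here the directions along
    e are among those removed. *)
Definition frame_x v (i : nat) : R :=
  nth 0 [:: 0; - (v.1.2 ^+ 2 + v.2 ^+ 2); v.1.1 * v.1.2; v.1.1 * v.2] i.

Definition frame_y v (i : nat) : R := nth 0 [:: 0; 0; - v.2; v.1.2] i.

Definition frame v : 'M[R]_(4, 2) :=
  \matrix_(i, j) if j == ord0 then frame_x v i else frame_y v i.

Lemma frame0 v i : frame v i ord0 = frame_x v i. Proof. by rewrite mxE. Qed.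
Lemma frame1 v i : frame v i ord_max = frame_y v i. Proof. by rewrite mxE. Qed.

Lemma punctured_scale i (s : R) v : (i < 6)%N -> punctured v ->
  ~ (v.1.1 = s * (line i).1.1 /\ v.1.2 = s * (line i).1.2 /\ v.2 = s * (@line R i).2).
Proof.
move=> i6 Pv [e1 [e2 e3]]; apply: (Pv i s i6).
by move: v e1 e2 e3 {Pv} => [[x y] z] /= -> -> ->.
Qed.

Lemma punctured_yz v : punctured v -> 0 < v.1.2 ^+ 2 + v.2 ^+ 2.
Proof.
move=> Pv; rewrite lt_neqAle addr_ge0 ?sqr_ge0 // andbT eq_sym.
apply/negP; rewrite paddr_eq0 ?sqr_ge0 // !sqrf_eq0 => /andP[/eqP y0 /eqP z0].
by apply: (@punctured_scale 0 v.1.1 v) => //=; rewrite y0 z0 mulr1 !mulr0.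
Qed.

(** For each pair of points, their coincidence puts v on one of the six lines. *)
Lemma frame_injective v : punctured v -> injective (fun i => row i (frame v)).
Proof.
move=> Pv i j.
have W0 := punctured_yz Pv.
have E k l : row k (frame v) = row l (frame v) ->
    frame_x v k = frame_x v l /\ frame_y v k = frame_y v l.
  move=> e; split.
    by have /rowP/(_ ord0) := e; rewrite !mxE.
  by have /rowP/(_ ord_max) := e; rewrite !mxE.
have N (k l : 'I_4) : (k < l)%N -> row k (frame v) <> row l (frame v).
  move=> kl /E[]; rewrite /frame_x /frame_y.
  move: k l kl; elim/ord4_ind; elim/ord4_ind => //= _ ex ey.
  - by move: W0 ex; lra.
  - have z0 : v.2 = 0 by lra.
    have x0 : v.1.1 = 0.
      move: W0; rewrite z0 expr0n addr0 => y0; apply/eqP.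
      have /esym/eqP := ex; rewrite mulf_eq0 => /orP[//|/eqP y1].
      by move: y0; rewrite y1 expr0n ltxx.
    by apply: (@punctured_scale 4 v.1.2 v) => //=; rewrite x0 z0; do !split; lra.
  - have y0 : v.1.2 = 0 by lra.
    have x0 : v.1.1 = 0.
      move: W0; rewrite y0 expr0n add0r => z0; apply/eqP.
      have /esym/eqP := ex; rewrite mulf_eq0 => /orP[//|/eqP z1].
      by move: z0; rewrite z1 expr0n ltxx.
    by apply: (@punctured_scale 2 v.2 v) => //=; rewrite x0 y0; do !split; lra.
  - have z0 : v.2 = 0 by lra.
    have y0 : v.1.2 != 0.
      by apply/eqP => y0; move: W0; rewrite z0 y0 expr0n addr0 ltxx.
    have x0 : v.1.1 = - v.1.2.
      by apply: (mulIf y0); rewrite -ex z0; ring.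
    by apply: (@punctured_scale 5 v.1.2 v) => //=; rewrite x0 z0; do !split; lra.
  - have y0 : v.1.2 = 0 by lra.
    have z0 : v.2 != 0.
      by apply/eqP => z0; move: W0; rewrite z0 y0 expr0n addr0 ltxx.
    have x0 : v.1.1 = - v.2.
      by apply: (mulIf z0); rewrite -ex y0; ring.
    by apply: (@punctured_scale 3 v.2 v) => //=; rewrite x0 y0; do !split; lra.
  - have y0 : v.1.2 = - v.2 by lra.
    have z0 : v.2 != 0.
      by apply/eqP => z0; move: W0; rewrite y0 z0 oppr0 expr0n addr0 ltxx.
    have x0 : v.1.1 = 0.
      apply: (mulIf z0); move: ex; rewrite y0 mul0r; lra.
    by apply: (@punctured_scale 1 v.2 v) => //=; rewrite x0 y0; do !split; lra.
move=> e; apply/val_inj; have [ij|ji|//] := ltngtP i j.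
  by case: (N _ _ ij).
by case: (N _ _ ji).
Qed.

(** The two coordinate rows of the frame are orthogonal, with squared lengths [Q]
    and [W]; the coefficients of a prescribed point are read off from them. *)
Lemma frame_span v : punctured v -> affine_span (frame v) = [set: 'rV[R]_2].
Proof.
move=> Pv; apply/seteqP; split=> // u _.
have W0 := punctured_yz Pv; set W := _ + _ in W0.
pose Q := W ^+ 2 + v.1.1 ^+ 2 * W.
have Q0 : 0 < Q.
  by apply: ltr_pwDl; [rewrite exprn_gt0|rewrite mulr_ge0 ?sqr_ge0 // ltW].
pose a := u ord0 ord0 / Q; pose b := u ord0 ord_max / W.
pose c (i : nat) := a * frame_x v i + b * frame_y v i.
pose C : 'rV[R]_4 := \row_i if i == o0 then 1 - (c 1%N + c 2%N + c 3%N) else c i.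
exists C; first by rewrite /= sum4 !mxE /=; ring.
have aQ : a * Q = u ord0 ord0 by rewrite /a divfK // gt_eqF.
have bW : b * W = u ord0 ord_max by rewrite /b divfK // gt_eqF.
apply/rowP; elim/ord2_ind; rewrite mxE sum4 !mxE /= /c /frame_x /frame_y /=.
  by rewrite -aQ /Q /W; ring.
by rewrite -bW /W; ring.
Qed.

Definition config_of v (Pv : punctured v) : config R 4 :=
  exist (fun M => M \in @config_set R 4) (frame v)
    (mem_set (conj (frame_injective Pv) (frame_span Pv))).

Lemma dx_frame v i : dx (frame v) i = frame_x v i.
Proof. by rewrite /dx !frame0 /frame_x /= subr0. Qed.

Lemma dy_frame v i : dy (frame v) i = frame_y v i.
Proof. by rewrite /dy !frame1 /frame_y /= subr0. Qed.

Lemma normal_frame v : normal (frame v) = (v.1.2 ^+ 2 + v.2 ^+ 2) *: v.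
Proof.
move: v => [[x y] z]; rewrite /normal !dx_frame !dy_frame /frame_x /frame_y.
by rewrite scale3E /=; congr (_, _, _); ring.
Qed.

Lemma norm1_scale (c : R) v : 0 < c -> norm1 (c *: v) = c * norm1 v.
Proof. by move=> c0; rewrite /norm1 !coord_scale !normrM !(gtr0_norm c0) !mulrDr. Qed.

(** The normal vector is only multiplied by a positive determinant under the
    group; dividing by a norm makes it invariant. *)
Definition direction M : R3 := (norm1 (normal M))^-1 *: normal M.

Lemma sum2 (F : 'I_2 -> R) : \sum_j F j = F ord0 + F ord_max.
Proof.
by rewrite !big_ord_recl big_ord0 addr0; congr (_ + F _); apply/val_inj.
Qed.

Lemma det2 (A : 'M[R]_2) :
  \det A = A ord0 ord0 * A ord_max ord_max - A ord0 ord_max * A ord_max ord0.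
Proof.
rewrite (expand_det_row _ ord0) sum2 /cofactor !det_mx11 !mxE /= expr0 mul1r.
rewrite expr1 mulN1r mulrN.
by congr (_ * A _ _ - _ * A _ _); apply/val_inj.
Qed.

(** Both rows of the frame of a positive multiple of the normal vector are double
    and triple cross products of the coordinate rows of [M], hence combinations
    of them by the expansion formula; [A] collects the coefficients, and its
    determinant is a positive multiple of the squared length of a nonzero
    vector. *)
Lemma frame_of_normal M (c : R) : 0 < c -> punctured (normal M) ->
  exists f, orientation_preserving_affine f /\
    forall i, row i (frame (c *: normal M)) = f (row i M).
Proof.
move=> c0 Pn; set X := dx M; set Z := dy M.
pose XX := X o1 ^+ 2 + X o2 ^+ 2 + X o3 ^+ 2.
pose XZ := X o1 * Z o1 + X o2 * Z o2 + X o3 * Z o3.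
pose ZZ := Z o1 ^+ 2 + Z o2 ^+ 2 + Z o3 ^+ 2.
pose A : 'M[R]_2 := \matrix_(i, j) if i == ord0
  then (if j == ord0 then c ^+ 2 * (Z o1 * XZ - X o1 * ZZ) else c * Z o1)
  else (if j == ord0 then c ^+ 2 * (X o1 * XZ - Z o1 * XX) else - c * X o1).
exists (fun u => u *m A - row o0 M *m A); split.
  exists A, (- (row o0 M *m A)); split=> //.
  rewrite det2 !mxE /=.
  rewrite (_ : _ - _ = c ^+ 3 * ((normal M).1.2 ^+ 2 + (normal M).2 ^+ 2)).
    by rewrite mulr_gt0 ?exprn_gt0 ?punctured_yz.
  by rewrite /normal /= -/X -/Z /XX /XZ /ZZ; ring.
have X0 : X o0 = 0 by rewrite /X /dx subrr.
have Z0 : Z o0 = 0 by rewrite /Z /dy subrr.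
move=> i; rewrite -mulmxBl; apply/rowP; elim/ord2_ind.
  rewrite mxE frame0 mxE sum2 !mxE /= -/(dx M i) -/(dy M i).
  rewrite /frame_x !coord_scale /normal /= -/X -/Z /XX /XZ /ZZ.
  by elim/ord4_ind: i => /=; rewrite ?X0 ?Z0; ring.
rewrite mxE frame1 mxE sum2 !mxE /= -/(dx M i) -/(dy M i).
rewrite /frame_y !coord_scale /normal /= -/X -/Z.
by elim/ord4_ind: i => /=; rewrite ?X0 ?Z0; ring.
Qed.

End configurations.

(** * The space of affine configurations as a cone complement *)

Section chart.
Context {R : realType}.
Local Notation R3 := (R * R * R)%type.
Local Notation X := (affine_config R 4).
Implicit Types (v : R3).

Lemma normal_orbit (p q : config R 4) : same_orbit p q ->
  exists2 c : R, 0 < c & normal (\val q) = c *: normal (\val p).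
Proof.
move=> /asboolP[f [[A [b [A0 fE]]] pq]]; exists (\det A) => //.
have Ex i : dx (\val q) i = dx (\val p) i * A ord0 ord0 + dy (\val p) i * A ord_max ord0.
  have E j : \val q j ord0 = \val p j ord0 * A ord0 ord0 +
      \val p j ord_max * A ord_max ord0 + b ord0 ord0.
    by have /rowP/(_ ord0) := pq j; rewrite fE !mxE sum2 !mxE.
  by rewrite /dx /dy !E; ring.
have Ey i : dy (\val q) i = dx (\val p) i * A ord0 ord_max + dy (\val p) i * A ord_max ord_max.
  have E j : \val q j ord_max = \val p j ord0 * A ord0 ord_max +
      \val p j ord_max * A ord_max ord_max + b ord0 ord_max.
    by have /rowP/(_ ord_max) := pq j; rewrite fE !mxE sum2 !mxE.
  by rewrite /dx /dy !E; ring.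
by rewrite /normal scale3E !Ex !Ey det2; congr (_, _, _); ring.
Qed.

Lemma config_normal (p : config R 4) : normal (\val p) != 0.
Proof. by have /set_mem[] := valP p; exact: normal_neq0. Qed.

Lemma direction_scale (c : R) v : 0 < c ->
  (norm1 (c *: v))^-1 *: (c *: v) = (norm1 v)^-1 *: v.
Proof.
move=> c0; rewrite norm1_scale // scalerA invfM mulrAC mulVf ?mul1r //.
by rewrite gt_eqF.
Qed.

Lemma direction_orbit (p q : config R 4) : same_orbit p q ->
  direction (\val p) = direction (\val q).
Proof.
by move=> /normal_orbit[c c0 E]; rewrite /direction E direction_scale.
Qed.

Definition normal_direction (q : X) : R3 := direction (\val (repr q)).

Lemma normal_direction_pi (p : config R 4) :
  normal_direction (\pi_X p) = direction (\val p).
Proof.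
apply: direction_orbit; have : \pi_X (repr (\pi_X p)) = \pi_X p by rewrite reprK.
by move=> /eqmodP.
Qed.

Lemma punctured_scaling (c : R) v : c != 0 -> punctured v -> punctured (c *: v).
Proof.
move=> c0 Pv i s i6 /(congr1 (fun w => c^-1 *: w)).
by rewrite !scalerA mulVf // scale1r => /(Pv _ _ i6).
Qed.

Lemma direction_punctured (p : config R 4) : punctured (direction (\val p)).
Proof.
apply: punctured_scaling.
  by rewrite invr_neq0 // gt_eqF // norm1_gt0 // config_normal.
by have /set_mem[ip ap] := valP p; apply: normal_punctured => //; exact: config_normal.
Qed.

Lemma direction_continuous : continuous (fun p : config R 4 => direction (\val p)).
Proof.
have cM i j : continuous (fun p : config R 4 => \val p i j : R).
  move=> p; apply: (@continuous_comp _ _ _ (fun p : config R 4 => \val p)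
    (fun M : 'M[R]_(4, 2) => M i j)); last exact: coord_continuous.
  exact: (@initial_continuous _ _ (fun p : config R 4 => \val p)).
have cdx i : continuous (fun p : config R 4 => dx (\val p) i).
  by apply: sub_fun_continuous; exact: cM.
have cdy i : continuous (fun p : config R 4 => dy (\val p) i).
  by apply: sub_fun_continuous; exact: cM.
have cn : [/\ continuous (fun p : config R 4 => (normal (\val p)).1.1),
  continuous (fun p : config R 4 => (normal (\val p)).1.2) &
  continuous (fun p : config R 4 => (normal (\val p)).2)].
  by split; apply: sub_fun_continuous; apply: mul_fun_continuous.
case: cn => c1 c2 c3.
have cabs (f : config R 4 -> R) : continuous f -> continuous (fun p => `|f p|).
  move=> cf p; apply: (@continuous_comp _ _ _ f Num.norm); first exact: cf.
  exact: norm_continuous.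
have cV : continuous (fun p : config R 4 => (norm1 (normal (\val p)))^-1).
  have : continuous (fun p : config R 4 => norm1 (normal (\val p))).
    apply: add_fun_continuous; last exact: cabs.
    by apply: add_fun_continuous; exact: cabs.
  move=> cN p; have nz : norm1 (normal (\val p)) != 0.
    by rewrite gt_eqF // norm1_gt0 // config_normal.
  exact: (@continuousV R (config R 4)
    (fun p : config R 4 => norm1 (normal (\val p))) p nz (cN p)).
by apply: pair_continuous; [apply: pair_continuous|]; exact: mul_fun_continuous.
Qed.

Lemma normal_direction_continuous : continuous normal_direction.
Proof.
apply/quotient_continuous => /=.
rewrite (_ : _ \o _ = fun p => direction (\val p)); last first.
  by apply/funext => p; exact: normal_direction_pi.
exact: direction_continuous.
Qed.

Lemma normal_direction_in q : punctured (normal_direction q).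
Proof. exact: direction_punctured. Qed.

Context (x0 : X).

(** The value [x0] off the domain is arbitrary. *)
Definition frame_config v : X :=
  if pselect (punctured v) is left Pv then \pi_X (config_of Pv) else x0.

Lemma frame_configE v (Pv : punctured v) : frame_config v = \pi_X (config_of Pv).
Proof.
rewrite /frame_config; case: pselect => // Pv'.
by rewrite (Prop_irrelevance Pv' Pv).
Qed.

Lemma normal_directionK : cancel normal_direction frame_config.
Proof.
move=> q; rewrite (frame_configE (@normal_direction_in q)) -[RHS]reprK; apply/eqmodP.
rewrite /= same_orbit_sym; apply/asboolP.
have /set_mem[ip ap] := valP (repr q).
apply: frame_of_normal.
  by rewrite invr_gt0 norm1_gt0 // config_normal.
by apply: normal_punctured => //; exact: config_normal.
Qed.

Lemma frame_configK v : punctured v ->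
  exists2 c : R, 0 < c & normal_direction (frame_config v) = c *: v.
Proof.
move=> Pv; exists (norm1 v)^-1.
  rewrite invr_gt0 norm1_gt0 //; apply/eqP => v0.
  by apply: (Pv 0%N 0) => //; rewrite scale0r.
rewrite (frame_configE Pv) normal_direction_pi /direction /= normal_frame direction_scale //.
exact: punctured_yz.
Qed.

Lemma frame_config_continuous (Z : topologicalType) (f : Z -> R3) :
  continuous f -> (forall z, punctured (f z)) -> continuous (frame_config \o f).
Proof.
move=> cf Pf.
have c1 : continuous (fun z => (f z).1.1).
  move=> z; apply: (@continuous_comp _ _ _ f (fun v => v.1.1)); first exact: cf.
  by apply: (@continuous_comp _ _ _ fst fst); exact: cvg_fst.
have c2 : continuous (fun z => (f z).1.2).
  move=> z; apply: (@continuous_comp _ _ _ f (fun v => v.1.2)); first exact: cf.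
  by apply: (@continuous_comp _ _ _ fst snd); [exact: cvg_fst|exact: cvg_snd].
have c3 : continuous (fun z => (f z).2).
  by move=> z; apply: (@continuous_comp _ _ _ f snd); [exact: cf|exact: cvg_snd].
have copp (h : Z -> R) : continuous h -> continuous (fun z => - h z).
  by move=> ch z; exact: (continuousN (ch z)).
have cfr : continuous (fun z => config_of (Pf z)).
  apply: continuous_comp_initial; apply: matrix_continuous => i j.
  have -> : (fun z => (\val \o (fun z => config_of (Pf z))) z i j) =
      fun z => frame (f z) i j by [].
  elim/ord2_ind: j.
    under eq_fun do rewrite frame0.
    elim/ord4_ind: i; rewrite /frame_x /=.
    - exact: const_fun_continuous.
    - by apply: copp; apply: add_fun_continuous; under eq_fun do rewrite expr2;
        exact: mul_fun_continuous.
    - exact: mul_fun_continuous.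
    - exact: mul_fun_continuous.
  under eq_fun do rewrite frame1.
  elim/ord4_ind: i; rewrite /frame_y /=; try exact: const_fun_continuous.
  - exact: copp.
  - exact: c2.
rewrite (_ : frame_config \o f = \pi_X \o (fun z => config_of (Pf z))); last first.
  by apply/funext => z; rewrite /= (frame_configE (Pf z)).
by move=> z; apply: continuous_comp; [exact: cfr|exact: pi_continuous].
Qed.

End chart.

(** * The fundamental group of the configuration space *)

Theorem mainTheorem3 (R : realType) (x : affine_config R 4) :
  group_isomorphic (fundamental_group R x) (free_group 'I_11).
Proof.
have c_normal := @normal_direction_continuous R.
have open_preimage (C : set (R * R * R)) : open C -> open (@normal_direction R @^-1` C).
  by move=> oC; apply: open_comp => // q _; exact: c_normal.
have star k := @star_joined R _ _ punctured _ _ (@normal_directionK R x) (@frame_configK R x)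
  (@frame_config_continuous R x) (slit k) (@slit_punctured R k) (@slit_cone R k).
have simple k := @star_simple R _ _ punctured _ _ c_normal (@normal_directionK R x)
  (@frame_config_continuous R x) (slit k) (@slit_punctured R k).
have gapP (j : 'I_12) : gap j `<=` @punctured R.
  move=> v gv; apply: (@slit_punctured R false).
  by have [] := (slit_gap v).2 (ex_intro2 _ _ (j : nat) (ltn_ord j) gv).
apply: (@pi1_two_charts_any_base R (affine_config R 4) 11
  (fun k => @normal_direction R @^-1` slit k) (fun j => @normal_direction R @^-1` gap j)).
- by move=> k; apply: open_preimage; exact: slit_open.
- by move=> j; apply: open_preimage; exact: gap_open.
- by move=> q; exact: slit_cover (@normal_direction_in R q).
- move=> q; split=> [/slit_gap[j j12 gj]|[j gj]].
    by exists (Ordinal j12).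
  by apply/slit_gap; exists (j : nat).
- move=> i j q gi gj; apply/val_inj.
  exact: gap_disjoint (ltn_ord i) (ltn_ord j) gi gj.
- move=> k y z; apply: (star k (pole k)); first exact: slit_pole.
  by move=> v sv s; exact: slit_star.
- move=> j y z gy gz.
  apply: (@segment_joined R _ _ punctured _ _ (@normal_directionK R x) (@frame_configK R x)
    (@frame_config_continuous R x) (gap j) (gapP j) (@gap_cone R j)).
  by move=> s; exact: gap_convex.
- move=> k y z p q; apply: (simple k (pole k)) => v sv s.
  exact: slit_star.
- move=> j; have [v gv] := @gap_nonempty R j (ltn_ord j).
  exists (frame_config x v) => /=; have [c c0 ->] := @frame_configK R x _ (gapP j _ gv).
  exact: gap_cone.
Qed.
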